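(* For every $\varepsilon>0$ there exists $g_0$ such that every graph $G$ of Euler genus $g\ge g_0$ satisfies $\chi'_{\mathrm{inj}}(G)\le (3+\varepsilon)g$. (That is, $\chi'_{\mathrm{inj}}(G)\le (3+o(1))g$ where $o(1)\to 0$ as $g\to\infty$.)
   Context: All graphs are finite and simple. An injective edge-coloring of a graph $G$ is a function $\psi:E(G)\to\mathbb N$ such that whenever $\psi(e)=\psi(e')$ for distinct edges $e,e'$, no third edge of $G$ joins an endpoint of $e$ to an endpoint of $e'$. The injective chromatic index $\chi'_{\mathrm{inj}}(G)$ is the minimum $k$ such that $G$ has an injective edge-coloring with colors in $\{1,\dots,k\}$. The Euler genus of a surface $S$ is $2-\chi(S)$, where $\chi(S)$ is its Euler characteristic (so the sphere has Euler genus $0$, the projective plane $1$, the torus and Klein bottle $2$); the Euler genus of a graph $G$ is the minimum Euler genus of a surface in which $G$ can be embedded. *)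

(* Defs.v *)
From mathcomp Require Import all_boot all_order all_algebra.
From mathcomp Require Import all_classical all_reals topology.

Set Implicit Arguments.
Unset Strict Implicit.
Unset Printing Implicit Defensive.

Import Order.TTheory GRing.Theory Num.Theory.
Import numFieldTopology.Exports.
Local Open Scope ring_scope.

Record sgraph := SGraph {
  vertex :> finType;
  adj : rel vertex;
  adj_sym : symmetric adj;
  adj_irr : irreflexive adj }.

Definition edges (G : sgraph) : {set {set G}} :=
  [set e : {set G} | [exists x, exists y, adj x y && (e == [set x; y]%SET)]]%SET.

(* The values of [psi] outside [edges G] are irrelevant. *)
Definition injective_edge_coloring (G : sgraph) (psi : {set G} -> nat) : Prop :=
  forall e e', e \in edges G -> e' \in edges G -> e != e' -> psi e = psi e' ->
  ~ exists f, [/\ f \in edges G, f != e, f != e' &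
      exists x y, [/\ x \in e, y \in e' & f = [set x; y]%SET]].

Definition injectively_colorable (G : sgraph) (k : nat) : Prop :=
  exists psi : {set G} -> nat,
    injective_edge_coloring psi /\
    {in edges G, forall e, (1 <= psi e <= k)%N}.

Lemma injectively_colorable_exists (G : sgraph) :
  exists k, `[< injectively_colorable G k >].
Proof.
exists #|{set G}|; apply/asboolP; exists (fun e => (enum_rank e).+1); split.
  by move=> e e' _ _ /eqP ne [] /ord_inj/enum_rank_inj.
by move=> e _ /=; apply: ltn_ord.
Qed.

Definition inj_chromatic_index (G : sgraph) : nat :=
  ex_minn (injectively_colorable_exists G).

(* Finite abstract simplicial complexes on a finite set [T] are given by the
   set of their nonempty faces; an element [x] of [T] is a vertex of [K] only
   if [[set x]] belongs to [K]. *)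
Section Complexes.
Variable T : finType.
Implicit Types (K L : {set {set T}}) (s t : {set T}) (v x y : T).

Definition simplicial_complex K : Prop :=
  finset.set0 \notin K /\
  forall s t, t \in K -> s \subset t -> s != finset.set0 -> s \in K.

Definition connected_complex K : Prop :=
  forall x y, [set x]%SET \in K -> [set y]%SET \in K ->
    connect [rel a b | [set a; b]%SET \in K] x y.

Definition link K v : {set {set T}} :=
  [set s | [&& s != finset.set0, v \notin s & v |: s \in K]]%SET.

Definition cycle_complex L : Prop :=
  [/\ L != finset.set0,
      connected_complex L,
      {in L, forall s, (#|s| <= 2)%N}
    & forall x, [set x]%SET \in L ->
        #|[set s in L | (x \in s) && (#|s| == 2)]%SET| = 2%N].

(* Every surface (compact connected 2-manifold without boundary) is homeomorphic
   to the realization of such a complex, by Rado's triangulation theorem. *)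
Definition triangulated_surface K : Prop :=
  [/\ simplicial_complex K,
      K != finset.set0,
      connected_complex K
    & forall v, [set v]%SET \in K -> cycle_complex (link K v)].

Definition euler_char K : int := \sum_(s in K) (-1) ^+ #|s|.-1.

Definition surface_euler_genus K : int := 2 - euler_char K.

(* Geometric realization, in barycentric coordinates; [{ptws T -> R}] is R^T
   with its product topology. *)
Definition realization (R : realType) K : set {ptws T -> R} :=
  fun p => [/\ forall v, 0 <= p v,
               \sum_v p v = 1
             & [set v | p v != 0]%SET \in K].

End Complexes.
Arguments realization {T} R K.

Definition graph_complex (G : sgraph) : {set {set G}} :=
  (edges G :|: [set [set x] | x : G])%SET.

(* The realization of [G] is compact and that of [K] is Hausdorff, so a
   continuous injection is a homeomorphism onto its image. *)
Definition embeds_in (R : realType) (G : sgraph) (T : finType)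
    (K : {set {set T}}) : Prop :=
  exists f : {ptws G -> R} -> {ptws T -> R},
    [/\ {within realization R (graph_complex G), continuous f}%classic,
        set_fun (realization R (graph_complex G)) (realization R K) f
      & set_inj (realization R (graph_complex G)) f].

Definition is_euler_genus (R : realType) (G : sgraph) (g : nat) : Prop :=
  (exists (T : finType) (K : {set {set T}}),
     [/\ triangulated_surface K, embeds_in R G K
       & surface_euler_genus K = g%:Z]) /\
  (forall (T : finType) (K : {set {set T}}),
     triangulated_surface K -> embeds_in R G K ->
     g%:Z <= surface_euler_genus K).

(* Main.v *)
(** Let [G] be embedded in a triangulated surface of Euler genus [g]. On a fine
    grid subdivision, the stars of grid points met by the image of a vertex
    neighborhood form connected, pairwise disjoint sets, joined along the images
    of the edges; this makes [G] a minor of the 1-skeleton, without any tameness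
    of the embedding. If [H] is a minor of the 1-skeleton with all vertices in
    branch sets, let [M] consist of spanning trees of the branch sets and one edge
    for each edge of [H]. Merging triangles across the edges outside [M] leaves at
    least [chi + e(H) - v(H)] faces; the boundary of each is an even set of edges,
    hence contains at least three edges of [H]; so [e(H) <= 3 v(H) + 3 g].

    For the coloring, repeatedly delete vertices of degree at most a constant [d].
    The remaining core has [O(g / d)] vertices, hence at most [(3 + O(1/d)) g]
    edges, which get distinct colors. A deleted edge [v -> x], oriented from the
    vertex deleted first, gets the pair [(c' v, c x)], where [c'] is a
    [d + 1]-coloring of the deleted part and [c] properly colors a graph whose
    density is controlled through star contractions of [G]; this costs [o(g)]
    colors. *)
Require Import Defs.
From mathcomp Require Import all_boot all_order all_algebra.
From mathcomp Require Import zify.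
Set Implicit Arguments.
Unset Strict Implicit.
Unset Printing Implicit Defensive.

(** * Euler's bound for minors of a closed surface *)

(** The embedding is only a continuous injection, so [G] itself has no rotation system and no faces
    to count. All topology is confined to finding [G] as a minor of an explicit grid; what is passed
    on is the single property [minor_sparse]. Merged faces need not be discs. An inequality
    suffices: each merge loses at most one face, and boundaries are controlled modulo 2, as edge
    sets meeting every vertex cut evenly. Such a nonempty set cannot stay inside the trees of the
    branch sets; and since [M] has one edge per adjacent pair, it cannot join just two branch sets
    either. This gives the three edges of [H]. Sparsity is demanded of all minors because the graph
    to be colored by [c] is not a subgraph of [G]: it also joins targets with a common source. When
    that source lies outside the vertex set under study, contracting it onto one of its targets
    makes the pair adjacent, and [d] contractions reach all such pairs. The coefficient 3 of [g]
    comes from the core alone. The pairs of colors cost about [d.+1 * (g / L.+1)], where [d] is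
    fixed first and [L] is then taken large compared with [d]. *)

Lemma connect_crossing (V : finType) (e : rel V) (S : {set V}) a b :
  connect e a b -> a \in S -> b \notin S ->
  exists x y, [/\ x \in S, y \notin S & e x y].
Proof.
case/connectP=> p; elim: p a => [|z p IHp] a /= => [_ -> -> //|].
case/andP=> eaz pz lb aS bS; have [zS|zS] := boolP (z \in S); last by exists a, z.
exact: IHp zS bS.
Qed.

(** A forest count without forests: a maximal [S] satisfying [P] is everything. A point with a new
    [p]-value raises the first term; otherwise a connecting path leaves [S] through an edge of [M],
    and adding its far end raises the second. This serves both for the vertices in branch sets and
    for the faces merged across edges outside [M]. *)
Lemma card_le_fibers (X J C : finType) (inc : X -> J -> bool) (M : {set J})
    (p : X -> C) :
  (forall j, #|[set x | inc x j]| = 2) ->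
  (forall x y, p x = p y ->
     connect [rel x y | [exists j in M, inc x j && inc y j]] x y) ->
  #|X| <= #|p @: [set: X]| + #|M|.
Proof.
move=> inc2 conn.
pose inside (S : {set X}) := [set j in M | [set x | inc x j] \subset S].
pose P (S : {set X}) := #|S| <= #|p @: S| + #|inside S|.
have P0 : P set0 by rewrite /P cards0.
have [S maxS _] := maxset_exists P0.
have PS : P S := maxsetp maxS.
suff ST : S = [set: X].
  move: PS; rewrite /P ST cardsT => /leq_trans; apply; rewrite leq_add2l.
  by apply: subset_leq_card; apply/subsetP=> j; rewrite inE => /andP[].
apply/setP=> x; rewrite inE; apply/negPn/negP=> xS.
have max z : z \notin S -> ~~ P (z |: S).
  move=> zS; apply/negP=> Pz.
  have := maxsetsup maxS Pz (subsetU1 z S) => Sz.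
  by move: zS; rewrite -Sz setU11.
have insS z : #|inside S| <= #|inside (z |: S)|.
  apply/subset_leq_card/subsetP=> j; rewrite !inE => /andP[-> /= jS].
  exact: subset_trans jS (subsetU1 z S).
have [pxS|pxS] := boolP (p x \in p @: S).
  case/imsetP: pxS => y yS pxy.
  have [s [z [sS zS]]] := connect_crossing (conn _ _ (esym pxy)) yS xS.
  case/exists_inP=> j jM /andP[sj zj].
  move/negP: (max z zS); apply; rewrite /P.
  have: #|inside S| < #|inside (z |: S)|.
    apply: proper_card; apply/properP; split.
      apply/subsetP=> i; rewrite !inE => /andP[-> /= iS].
      exact: subset_trans iS (subsetU1 z S).
    exists j; rewrite inE jM /=; last first.
      by apply/negP=> /subsetP /(_ z); rewrite inE zj => /(_ isT); apply/negP.
    have: [set s; z] == [set x | inc x j].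
      rewrite eqEcard inc2 cards2; have -> : s != z.
        by apply: contraNneq zS => <-.
      by rewrite andbT; apply/subsetP=> w /set2P[]->; rewrite inE.
    by move/eqP <-; apply/subsetP=> w /set2P[]->; rewrite !inE ?eqxx ?sS ?orbT.
  have : #|p @: S| <= #|p @: (z |: S)|.
    by apply/subset_leq_card/imsetS/subsetU1.
  move: PS; rewrite /P cardsU1 zS; lia.
move/negP: (max x xS); apply; rewrite /P imsetU1 !cardsU1 xS pxS.
move: PS (insS x); rewrite /P; lia.
Qed.

Lemma odd_sum (I : finType) (D : {set I}) (F : I -> nat) :
  odd (\sum_(i in D) F i) = odd #|[set i in D | odd (F i)]|.
Proof.
rewrite -sum1_card !(big_morph odd oddD (erefl _)) big_mkcond [RHS]big_mkcond /=.
by apply: eq_bigr => i _; rewrite inE; case: (i \in D) => //=; case: (odd _).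
Qed.

(** Incidences between [A] and [D] are counted from both sides modulo 2. Two applications, to
    vertices and edges and then to faces and edges, show that the boundary of a set of faces meets
    every vertex cut evenly. *)
Lemma odd_double_count (X Y : finType) (r : X -> Y -> bool) (A : {set X})
    (D : {set Y}) :
  (forall x, x \in A -> ~~ odd #|[set y in D | r x y]|) ->
  ~~ odd #|[set y in D | odd #|[set x in A | r x y]|]|.
Proof.
move=> ev; rewrite -(odd_sum D (fun y => #|[set x in A | r x y]|)).
have -> : \sum_(y in D) #|[set x in A | r x y]|
        = \sum_(x in A) #|[set y in D | r x y]|.
  under eq_bigr do rewrite -sum1dep_card big_mkcondr.
  under [RHS]eq_bigr do rewrite -sum1dep_card big_mkcondr.
  exact: exchange_big.
rewrite (odd_sum A (fun x => #|[set y in D | r x y]|)).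
rewrite (_ : [set x in A | _] = set0) ?cards0 //.
by apply/setP=> x; rewrite !inE; apply/negbTE; case: (boolP (x \in A)) => //= /ev.
Qed.

Definition cell_adj (X J : finType) (inc : X -> J -> bool) : rel X :=
  [rel x y | [exists j, inc x j && inc y j]].

(* [inc0 x e]: [x] is an end of [e]; [inc1 f e]: [e] is a side of [f]. The third
   clause is the mod 2 identity that a boundary has no boundary. *)
Definition closed_surface (V E F : finType) (inc0 : V -> E -> bool)
    (inc1 : F -> E -> bool) : Prop :=
  [/\ forall e, #|[set x | inc0 x e]| = 2,
      forall e, #|[set f | inc1 f e]| = 2,
      forall x f, ~~ odd #|[set e | inc0 x e && inc1 f e]|,
      forall x y, connect (cell_adj inc0) x y
    & forall f f', connect (cell_adj inc1) f f'].

Definition fiber_adj (A B : finType) (eA : rel A) (p : A -> option B) u : rel A :=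
  [rel x y | [&& eA x y, p x == Some u & p y == Some u]].

(* [p] exhibits the graph [eB] on [U] as a minor of [eA]: the branch set of [u]
   is [p @^-1 (Some u)]. *)
Definition minor_map (A B : finType) (eA : rel A) (U : {set B}) (eB : rel B)
    (p : A -> option B) : Prop :=
  [/\ forall u, u \in U -> exists a, p a = Some u,
      forall u a b, u \in U -> p a = Some u -> p b = Some u ->
        connect (fiber_adj eA p u) a b
    & forall u v, u \in U -> v \in U -> eB u v ->
        exists a b, [/\ p a = Some u, p b = Some v & eA a b]].

(** * Euler's inequality for a minor whose branch sets cover all vertices *)

Section EulerCount.
Variables (V E F B : finType) (inc0 : V -> E -> bool) (inc1 : F -> E -> bool).
Hypothesis surf : closed_surface inc0 inc1.
Variables (U : {set B}) (eB : rel B) (p : V -> B).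
Hypotheses (eB_irr : irreflexive eB) (pU : forall x, p x \in U).
Hypothesis pmodel : minor_map (cell_adj inc0) U eB (fun x => Some (p x)).

Let ends2 e : #|[set x | inc0 x e]| = 2. Proof. by case: surf. Qed.
Let sides2 e : #|[set f | inc1 f e]| = 2. Proof. by case: surf. Qed.

Let fadj (M : {set E}) : rel V :=
  [rel x y | (p x == p y) && [exists e in M, inc0 x e && inc0 y e]].

Let real (e : E) (q : B * B) :=
  [exists x, exists y, [&& inc0 x e, inc0 y e, p x == q.1 & p y == q.2]].

Let pairs := [set q in setX U U | eB q.1 q.2].

Let Q (M : {set E}) :=
  [forall x, forall y, (p x == p y) ==> connect (fadj M) x y] &&
  [forall q in pairs, exists e in M, real e q].

Let QT : Q [set: E].
Proof.
case: pmodel => _ conn edg; apply/andP; split.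
  apply/forallP=> x; apply/forallP=> y; apply/implyP=> /eqP pxy.
  apply: connect_sub (conn (p x) x y (pU x) erefl _); last by rewrite pxy.
  move=> a b /=; rewrite /fiber_adj /= => /and3P[/existsP[e ab] pa pb].
  apply: connect1; rewrite /fadj /=; apply/andP; split.
    by move: pa pb => /eqP[->] /eqP[->].
  by apply/existsP; exists e; rewrite inE.
apply/forall_inP=> [[u v]]; rewrite !inE /= => /andP[/andP[uU vU] uv].
case: (edg u v uU vU uv) => a [b [[pa] [pb] /existsP[e /andP[ae be]]]].
apply/exists_inP; exists e => //; apply/existsP; exists a; apply/existsP; exists b.
by rewrite ae be pa pb !eqxx.
Qed.

Let intra e := [forall x, forall y, inc0 x e ==> inc0 y e ==> (p x == p y)].

Let endsE e x y : inc0 x e -> inc0 y e -> x != y -> [set z | inc0 z e] = [set x; y].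
Proof.
move=> xe ye xy; apply/esym/eqP; rewrite eqEcard ends2 cards2 xy andbT.
by apply/subsetP=> z /set2P[]->; rewrite inE.
Qed.

Let ends_or e x y z : inc0 x e -> inc0 y e -> x != y -> inc0 z e -> z = x \/ z = y.
Proof.
move=> xe ye xy ze; have : z \in [set z | inc0 z e] by rewrite inE.
by rewrite (endsE xe ye xy) => /set2P.
Qed.

Let endsP e : exists x y, [/\ x != y, inc0 x e & inc0 y e].
Proof.
have /eqP/cards2P[x [y [xy E2]]] := ends2 e; exists x, y; split=> //.
  by have := set21 x y; rewrite -E2 inE.
by have := set22 x y; rewrite -E2 inE.
Qed.

(* [M] is a minimal edge set still realizing the minor, so that its edges inside
   fibers are bridges there; [D] is to be the boundary of a set of faces. *)
Lemma card_pairs_le_tree_complement : exists M : {set E},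
  [/\ #|V| <= #|U| + #|[set e in M | intra e]|,
      #|pairs| <= 2 * #|[set e in M | ~~ intra e]|
    & forall D : {set E}, D \subset M -> D != set0 ->
      (forall S : {set V}, ~~ odd #|[set e in D | odd #|[set x in S | inc0 x e]|]|) ->
      3 <= #|[set e in D | ~~ intra e]|].
Proof.
have [M minM _] := minset_exists QT.
have /andP[/forallP Mc /forall_inP Me] : Q M := minsetp minM.
have notQ e : e \in M -> ~~ Q (M :\ e).
  move=> eM; apply/negP=> Qe.
  have := minsetinf minM Qe (subD1set M e) => ME.
  by move: eM; rewrite -ME !inE eqxx.
exists M; split.
- have := @card_le_fibers _ _ _ inc0 [set e in M | intra e] p ends2.
  move=> H; apply: leq_trans (H _) _; last first.
    rewrite leq_add2r; apply/subset_leq_card/subsetP=> _ /imsetP[x _ ->].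
    exact: pU.
  move=> x y pxy; have := forallP (Mc x) y; rewrite pxy eqxx /=.
  apply: connect_sub => a b /andP[/eqP pab /exists_inP[e eM /andP[ae be]]].
  have [->//|ab] := eqVneq a b.
  apply: connect1; apply/existsP; exists e; rewrite inE eM ae be /= andbT.
  apply/forallP=> z; apply/forallP=> w; apply/implyP=> ze; apply/implyP=> we.
  by case: (ends_or ae be ab ze) => ->; case: (ends_or ae be ab we) => ->; rewrite ?pab.
- have -> : #|pairs| = \sum_(q in pairs) 1 by rewrite sum1_card.
  (* An edge realizing a pair crosses between fibers because [eB] is irreflexive, and a crossing
     edge realizes at most the two orders of one pair. *)
  apply: (@leq_trans (\sum_(q in pairs) \sum_(e in M | ~~ intra e && real e q) 1)).
    apply: leq_sum => q qP; case/exists_inP: (Me q qP) => e eM rq.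
    rewrite (bigD1 e) //= eM rq andbT /=; apply/negP=> /forallP ie.
    case/existsP: rq => x /existsP[y /and4P[xe ye /eqP pxq /eqP pyq]].
    have /forallP/(_ y) := ie x; rewrite xe ye /= pxq pyq => /eqP q12.
    by move: qP; rewrite !inE q12 eB_irr andbF.
  rewrite (exchange_big_dep [pred e | (e \in M) && ~~ intra e]) /=; last first.
    by move=> q e _ /and3P[-> ->].
  rewrite mulnC -sum1dep_card big_distrl /=; apply: leq_sum => e /andP[eM ie].
  rewrite mul1n sum1dep_card.
  have [x [y [xy xe ye]]] := endsP e.
  apply: (@leq_trans #|[set (p x, p y); (p y, p x)]|); last by rewrite cards2; case: eqP.
  apply/subset_leq_card/subsetP=> [[u v]]; rewrite !inE /=.
  case/andP=> /andP[_ uv] /and3P[_ _ /existsP[z /existsP[w /and4P[ze we /eqP pz /eqP pw]]]].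
  move: pz pw => /= pz pw; case: (ends_or xe ye xy ze) pz => -> pz; case: (ends_or xe ye xy we) pw => -> pw.
  + by move: uv; rewrite -pz -pw eB_irr.
  + by rewrite -pz -pw eqxx.
  + by rewrite -pz -pw eqxx orbT.
  + by move: uv; rewrite -pz -pw eB_irr.
move=> D DM D0 cutD.
(* Minimality: a crossing edge does not help to connect a fiber, so deleting it must leave some pair
   unrealized. Hence it is the only edge of [M] between its two fibers. *)
have crossP e : e \in M -> ~~ intra e -> exists x y, [/\ inc0 x e, inc0 y e, p x != p y &
    forall e' x' y', e' \in M -> inc0 x' e' -> inc0 y' e' -> p x' = p x -> p y' = p y -> e' = e].
  move=> eM ie; have := notQ e eM; rewrite negb_and => /orP[/forallPn[x]|].
    case/forallPn=> y; rewrite negb_imply => /andP[pxy]; case/negP.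
    have := forallP (Mc x) y; rewrite pxy /=.
    apply: connect_sub => a b /andP[/eqP pab /exists_inP[e' eM' /andP[ae be]]].
    have [->//|ab] := eqVneq a b.
    apply: connect1; rewrite /fadj /= pab eqxx; apply/existsP; exists e'.
    rewrite !inE eM' ae be !andbT; apply: contraNneq ie => ee.
    rewrite -ee; apply/forallP=> z; apply/forallP=> w; apply/implyP=> ze; apply/implyP=> we.
    by case: (ends_or ae be ab ze) => ->; case: (ends_or ae be ab we) => ->; rewrite ?pab.
  case/forall_inPn=> q qP; rewrite negb_exists_in => /forall_inP only.
  case/exists_inP: (Me q qP) => e' eM' rq.
  have ee : e' = e.
    apply/eqP; apply: contraTT rq => ee; apply: only.
    by rewrite !inE ee eM'.
  rewrite {}ee {eM' e'} in rq.
  case/existsP: rq => x /existsP[y /and4P[xe ye /eqP pxq /eqP pyq]].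
  exists x, y; split=> //.
    by apply: contraTneq qP => pxy; rewrite !inE -pxq -pyq pxy eB_irr andbF.
  move=> e' x' y' eM' xe' ye' px' py'; apply/eqP/negPn/negP=> ee.
  have /negP := only e' ltac:(by rewrite !inE ee eM'); apply.
  apply/existsP; exists x'; apply/existsP; exists y'.
  by rewrite xe' ye' px' py' pxq pyq !eqxx.
have oddcut e (S : {set V}) x y : inc0 x e -> inc0 y e -> x \in S -> y \notin S ->
    odd #|[set z in S | inc0 z e]|.
  move=> xe ye xS yS; have xy : x != y by apply: contraNneq yS => <-.
  rewrite (_ : [set z in S | _] = [set x]) ?cards1 //; apply/setP=> z; rewrite !inE.
  apply/andP/eqP=> [[zS ze]|->//].
  by case: (ends_or xe ye xy ze) => // zy; rewrite zy (negPf yS) in zS.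
have cutP e (S : {set V}) : odd #|[set z in S | inc0 z e]| ->
    exists x y, [/\ inc0 x e, inc0 y e, x \in S & y \notin S].
  move=> od; have [x [y [xy xe ye]]] := endsP e.
  have E2 : [set z in S | inc0 z e] = [set z in [set x; y] | z \in S].
    by rewrite -(endsE xe ye xy); apply/setP=> z; rewrite !inE andbC.
  have [xS|xS] := boolP (x \in S); have [yS|yS] := boolP (y \in S).
  - move: od; rewrite E2 (_ : [set z in _ | _] = [set x; y]) ?cards2 ?xy //.
    by apply/setP=> z; rewrite !inE; case: eqP => [->|_] /=; [rewrite xS|case: eqP => // ->].
  - by exists x, y.
  - by exists y, x.
  - move: od; rewrite E2 (_ : [set z in _ | _] = set0) ?cards0 //.
    apply/setP=> z; rewrite !inE; case: eqP => [->|_] /=; first exact: negbTE.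
    by case: eqP => // ->; rewrite (negbTE yS).
have cut2 (S : {set V}) e : e \in D -> odd #|[set z in S | inc0 z e]| ->
    exists e', [/\ e' \in D, e' != e & odd #|[set z in S | inc0 z e']|].
  move=> eD oe; have := cutD S; set C := [set _ in D | _].
  have eC : e \in C by rewrite inE eD.
  rewrite (cardsD1 e) eC /= negbK => oC.
  have /card_gt0P[e'] : 0 < #|C :\ e| by case: #|_| oC.
  by rewrite !inE => /and3P[e'e e'D oe']; exists e'.
(* If [D] contains an edge inside a fiber, that edge is a bridge there by minimality. The cut around
   one side [S] of the bridge has a second edge in [D], which must cross between fibers, since
   otherwise its far end would belong to [S]. *)
have [e1 e1D e1c] : exists2 e, e \in D & ~~ intra e.
  have [e eD] : exists e, e \in D by apply/set0Pn.
  have eM := subsetP DM e eD.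
  have [ie|] := boolP (intra e); last by exists e.
  have := notQ e eM; rewrite negb_and => /orP[/forallPn[x]|]; last first.
    case/forall_inPn=> q qP; rewrite negb_exists_in => /forall_inP only.
    case/exists_inP: (Me q qP) => e' eM' rq.
    have ee : e' = e.
      by apply/eqP; apply: contraTT rq => ee; apply: only; rewrite !inE ee eM'.
    rewrite {}ee {eM' e'} in rq.
    case/existsP: rq => x /existsP[y /and4P[xe ye /eqP pxq /eqP pyq]].
    have /forallP/(_ y) := forallP ie x; rewrite xe ye /= pxq pyq => /eqP q12.
    by move: qP; rewrite !inE q12 eB_irr andbF.
  case/forallPn=> y; rewrite negb_imply => /andP[/eqP pxy nxy].
  pose S := [set z | connect (fadj (M :\ e)) x z].
  have yS : y \notin S by rewrite inE.
  have xS : x \in S by rewrite inE connect0.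
  have := forallP (Mc x) y; rewrite pxy eqxx /= => cxy.
  have [a [b [aS bS /andP[/eqP pab /exists_inP[e' eM' /andP[ae be]]]]]] := connect_crossing cxy xS yS.
  have ee : e' = e.
    apply/eqP; apply: contraNT bS => ee; move: aS; rewrite !inE => aS; apply: (connect_trans aS).
    apply: connect1; rewrite /fadj /= pab eqxx; apply/existsP; exists e'.
    by rewrite !inE ee eM' ae be.
  rewrite {}ee {eM' e'} in ae be.
  have [e' [e'D e'e oe']] := cut2 S e eD (oddcut e S a b ae be aS bS).
  exists e' => //; apply/negP=> ie'.
  have [z [w [ze we zS wS]]] := cutP _ _ oe'.
  case/negP: wS; move: zS; rewrite !inE => zS; apply: (connect_trans zS); apply: connect1.
  have /forallP/(_ w) := forallP ie' z; rewrite ze we /= => pzw.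
  rewrite /fadj /= pzw; apply/existsP; exists e'.
  by rewrite !inE e'e (subsetP DM) // ze we.
have crossD e z w : inc0 z e -> inc0 w e -> p z != p w -> ~~ intra e.
  move=> ze we; apply: contraNN => /forallP/(_ z)/forallP/(_ w).
  by rewrite ze we.
(* [e1] joins the fibers of [x] and [y]. The cut around the fiber of [x] yields [e2], which by
   uniqueness ends in a third fiber; the cut around that one yields [e3], and [e1] does not touch
   it. *)
have [x [y [xe ye pxy uniq1]]] := crossP e1 (subsetP DM _ e1D) e1c.
pose fib z := [set z' | p z' == p z].
have fibP z w : p z != p w -> (z \in fib z) && (w \notin fib z).
  by rewrite !inE eqxx /= eq_sym.
have /andP[x1 y1] := fibP x y pxy.
have [e2 [e2D e21 oe2]] := cut2 (fib x) e1 e1D (oddcut _ _ _ _ xe ye x1 y1).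
have [a [b [ae be]]] := cutP _ _ oe2; rewrite !inE => /eqP pax pbx.
have pby : p b != p y.
  apply: contraNneq e21 => pby; apply/eqP.
  exact: (uniq1 e2 a b (subsetP DM _ e2D)).
have pba : p b != p a by rewrite pax.
have /andP[b2 a2] := fibP b a pba.
have [e3 [e3D e32 oe3]] := cut2 (fib b) e2 e2D (oddcut _ _ _ _ be ae b2 a2).
have [c [d [ce de]]] := cutP _ _ oe3; rewrite !inE => /eqP pcb pdb.
have xy : x != y by apply: contraNneq pxy => ->.
have e31 : e3 != e1.
  apply: contraNneq pbx => e31; rewrite e31 in ce.
  case: (ends_or xe ye xy ce) => cE; rewrite -pcb cE // in pby *.
  by rewrite eqxx in pby.
apply: (@leq_trans #|[set e1; e2; e3]|).
  by rewrite -setUA cardsU1 cards2 !inE eq_sym (negbTE e21) eq_sym (negbTE e31) eq_sym (negbTE e32).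
apply/subset_leq_card/subsetP=> e; rewrite !inE => /orP[/orP[]|] /eqP ->.
- by rewrite e1D.
- by rewrite e2D (crossD _ b a).
- by rewrite e3D (crossD _ c d) // pcb eq_sym.
Qed.


(** With [C] the set of merged faces, the hypothesis and two uses of [card_le_fibers] give
    [#|Mc| + 2 <= #|C| + #|U| + g]. Each boundary has three crossing edges and each edge lies on at
    most two boundaries, so [3 * #|C| <= 2 * #|Mc|], and [#|Mc|] is at most three times
    [#|U| + g]. *)
Lemma card_pairs_closed_surface g :
  #|E| + 2 <= #|V| + #|F| + g -> 0 < #|U| -> #|pairs| <= 6 * (#|U| + g).
Proof.
move=> chi U0; have [M [cV cP c3]] := card_pairs_le_tree_complement.
pose Mc := [set e in M | ~~ intra e].
have cM : #|M| = #|[set e in M | intra e]| + #|Mc|.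
  rewrite -(cardsID [set e | intra e] M); congr (_ + _); apply: eq_card => e.
    by rewrite !inE.
  by rewrite !inE andbC.
pose dadj : rel F := [rel f f' | [exists e in ~: M, inc1 f e && inc1 f' e]].
have dsym : connect_sym dadj.
  apply: sym_connect_sym => f f' /=.
  by apply: eq_existsb => e; rewrite [inc1 f e && _]andbC.
pose cls f := [set f' | connect dadj f f'].
pose C := cls @: [set: F].
have clsE f f' : f' \in cls f -> cls f' = cls f.
  rewrite inE => ff'; apply/setP=> h; rewrite !inE.
  by apply/idP/idP; apply: connect_trans; rewrite // dsym.
have cF : #|F| <= #|C| + #|~: M|.
  apply: (card_le_fibers sides2) => f f' ff'.
  have : f' \in cls f by rewrite ff' inE connect0.
  by rewrite inE.
have cMC := cardsC M.
(* A single merged face has empty boundary, so the bound by three fails for it; the first inequality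
   then suffices by itself. *)
have hub : #|C| <= 1 \/ 3 * #|C| <= 2 * #|Mc|.
  case: (leqP #|C| 1) => C1; [by left|right].
  pose D (A : {set F}) := [set e | odd #|[set f in A | inc1 f e]|].
  have sidesP e f f' : inc1 f e -> inc1 f' e -> f != f' ->
      [set h | inc1 h e] = [set f; f'].
    move=> fe fe' ff'; apply/esym/eqP; rewrite eqEcard sides2 cards2 ff' andbT.
    by apply/subsetP=> h /set2P[]->; rewrite inE.
  have DM A : A \in C -> D A \subset M.
    case/imsetP=> f0 _ ->; apply/subsetP=> e; rewrite inE; apply: contraTT => eM.
    have /eqP/cards2P[f [f' [ff' E2]]] := sides2 e.
    have fe : inc1 f e by have := set21 f f'; rewrite -E2 inE.
    have fe' : inc1 f' e by have := set22 f f'; rewrite -E2 inE.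
    have df : connect dadj f f'.
      by apply: connect1; apply/existsP; exists e; rewrite inE eM fe fe'.
    have same : (f \in cls f0) = (f' \in cls f0).
      rewrite !inE; apply/idP/idP => h; apply: connect_trans h _ => //.
      by rewrite dsym.
    have -> : [set h in cls f0 | inc1 h e] = [set h in [set f; f'] | h \in cls f0].
      by rewrite -E2; apply/setP=> h; rewrite !inE andbC.
    case: (boolP (f \in cls f0)) => fA.
      rewrite (_ : [set h in _ | _] = [set f; f']) ?cards2 ?ff' //.
      apply/setP=> h; rewrite in_set; case: (boolP (h \in _)) => // /set2P[]-> //.
      by rewrite -same.
    rewrite (_ : [set h in _ | _] = set0) ?cards0 //.
    apply/setP=> h; rewrite in_set in_set0; case: (boolP (h \in _)) => // /set2P[]->.
      exact: negbTE.
    by rewrite -same; apply: negbTE.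
  have D3 A : A \in C -> 3 <= #|[set e in D A | ~~ intra e]|.
    move=> CA; apply: (c3 (D A) (DM A CA)); last first.
      move=> S; apply: odd_double_count => x _.
      have := @odd_double_count _ _ inc1 A [set e | inc0 x e].
      rewrite (_ : [set e in D A | inc0 x e] =
        [set e in [set e | inc0 x e] | odd #|[set f in A | inc1 f e]|]); last first.
        by apply/setP=> e; rewrite !inE andbC.
      apply=> f _; case: surf => _ _ ev _ _; have := ev x f.
      by congr (~~ odd _); apply: eq_card => e; rewrite !inE.
    have [f fA] : exists f, f \in A.
      by case/imsetP: CA => f _ ->; exists f; rewrite inE connect0.
    have [f' fA'] : exists f', f' \notin A.
      apply/existsP; rewrite -negb_forall; apply/negP=> /forallP AT.
      move: C1; apply/negP; rewrite -leqNgt; rewrite -(cards1 A).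
      apply/subset_leq_card/subsetP=> _ /imsetP[h _ ->]; rewrite inE.
      by case/imsetP: CA AT => h0 _ -> AT; rewrite (clsE h0 h).
    case: surf => _ _ _ _ /(_ f f') cff'.
    have [h [h' [hA hA' /existsP[e /andP[he he']]]]] := connect_crossing cff' fA fA'.
    have hh : h != h' by apply: contraNneq hA' => <-.
    apply/set0Pn; exists e; rewrite inE.
    rewrite (_ : [set _ in A | _] = [set h]) ?cards1 //; apply/setP=> k.
    rewrite !inE; apply/andP/eqP=> [[kA ke]|->//].
    have : k \in [set h; h'] by rewrite -(sidesP e h h') // inE.
    by case/set2P=> // kE; rewrite -kE kA in hA'.
  apply: (@leq_trans (\sum_(A in C) #|[set e in D A | ~~ intra e]|)).
    by rewrite mulnC -sum_nat_const; apply: leq_sum.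
  have -> : \sum_(A in C) #|[set e in D A | ~~ intra e]|
          = \sum_(A in C) \sum_(e | ~~ intra e && (e \in D A)) 1.
    by apply: eq_bigr => A _; rewrite -sum1dep_card; apply: eq_bigl => e; rewrite andbC.
  rewrite (exchange_big_dep [pred e in Mc]) /=; last first.
    by move=> A e CA /andP[ie eD]; rewrite inE ie (subsetP (DM A CA)).
  rewrite mulnC -sum_nat_const; apply: leq_sum => e _; rewrite sum1dep_card.
  apply: (@leq_trans #|cls @: [set f | inc1 f e]|); last first.
    by rewrite -(sides2 e); apply: leq_imset_card.
  apply/subset_leq_card/subsetP=> A; rewrite inE => /and3P[CA _].
  rewrite inE => oA; have /card_gt0P[f] : 0 < #|[set f in A | inc1 f e]|.
    by case: #|_| oA.
  rewrite inE => /andP[fA fe]; apply/imsetP; exists f; first by rewrite inE.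
  by case/imsetP: CA fA => h _ -> /clsE ->.
rewrite -/Mc in cP; move: cV cP cM cF cMC hub chi U0.
move: #|pairs| #|Mc| #|C| #|[set e in M | intra e]| #|U| #|M| #|~: M| #|E| #|F| #|V|.
move=> a b c d h i j k l m; clear. lia.
Qed.

End EulerCount.

(** * Extending, composing and constructing minor maps *)

(** Euler's count needs every vertex in a branch set. A vertex without a label in [U] that is
    adjacent to a labelled one can be absorbed by its branch set, and connectivity of the host graph
    supplies such a vertex as long as any is left. *)
Lemma minor_map_total (A B : finType) (eA : rel A) (U : {set B}) (eB : rel B)
    (p : A -> option B) :
  symmetric eA -> (forall x y, connect eA x y) -> U != set0 ->
  minor_map eA U eB p ->
  exists2 q : A -> B, forall x, q x \in U & minor_map eA U eB (fun x => Some (q x)).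
Proof.
move=> symA conA /set0Pn[u0 u0U].
pose ok (p : A -> option B) x := if p x is Some u then u \in U else false.
have [k] := ubnP #|[set x | ~~ ok p x]|; elim: k p => // k IHk p ltk pm.
case: (pm) => surj conn edg.
have [allok|] := boolP [forall x, ok p x].
  pose q x := odflt u0 (p x).
  have qE x : p x = Some (q x).
    by move/forallP: allok => /(_ x); rewrite /ok /q; case: (p x).
  exists q => [x|]; first by move/forallP: allok => /(_ x); rewrite /ok qE.
  have EE a b u : fiber_adj eA p u a b = fiber_adj eA (fun x => Some (q x)) u a b.
    by rewrite /fiber_adj /= !qE.
  split=> [u /surj[a] | u a b uU | u v uU vU /(edg _ _ uU vU)[a [b]]].
  - by rewrite qE => pa; exists a.
  - by rewrite -!qE => pa pb; rewrite -(eq_connect (fun c d => EE c d u)); apply: conn.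
  - by rewrite !qE => h; exists a, b.
case/forallPn=> x0 nx0; have [y0 py0] := surj u0 u0U.
pose S := [set x | ok p x].
have y0S : y0 \in S by rewrite inE /ok py0.
have x0S : x0 \notin S by rewrite inE.
have [s [z [sS zS sz]]] := connect_crossing (conA y0 x0) y0S x0S.
pose p' x := if x == z then p s else p x.
have [w ps wU] : exists2 w, p s = Some w & w \in U.
  by move: sS; rewrite inE /ok; case: (p s) => // w wU; exists w.
have pz u : u \in U -> p z != Some u.
  by move=> uU; apply: contraNneq zS => pzu; rewrite inE /ok pzu.
have keep u a : u \in U -> p a = Some u -> p' a = Some u.
  by move=> uU pa; rewrite /p'; case: eqP => // az; move: (pz u uU); rewrite -az pa eqxx.
apply: (IHk p').
  rewrite -ltnS; apply: leq_trans ltk; rewrite ltnS.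
  apply: proper_card; apply/properP; split.
    apply/subsetP=> x; rewrite !inE; apply: contra; rewrite /ok /p'.
    by case: eqP => // ->; rewrite ps.
  by exists z; rewrite !inE; [move: zS; rewrite inE|rewrite /ok /p' eqxx ps wU].
have sub u : u \in U -> subrel (connect (fiber_adj eA p u)) (connect (fiber_adj eA p' u)).
  move=> uU; apply: connect_sub => a b /and3P[ab /eqP pa /eqP pb].
  by apply: connect1; rewrite /fiber_adj /= ab (keep u a) // (keep u b) ?eqxx.
have fsym u : connect_sym (fiber_adj eA p' u).
  by apply: sym_connect_sym => a b; rewrite /fiber_adj /= symA [(p' a == _) && _]andbC.
split=> [u uU | u a b uU | u v uU vU /(edg _ _ uU vU)[a [b [pa pb ab]]]].
- by have [a pa] := surj u uU; exists a; apply: keep.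
- have to c : p' c = Some u -> exists2 c', p c' = Some u & connect (fiber_adj eA p' u) c c'.
    rewrite {1}/p'; case: eqP => [-> psu|_ pc]; last by exists c.
    exists s => //; apply: connect1.
    by rewrite /fiber_adj /= symA sz /p' eqxx psu eqxx; case: ifP => _; rewrite eqxx.
  move=> /to[a' pa' aa'] /to[b' pb' bb']; apply: connect_trans aa' _.
  apply: (@connect_trans _ _ b'); last by rewrite fsym.
  by apply: sub => //; apply: conn.
- by exists a, b; split=> //; apply: keep.
Qed.

(** Paths lift: each vertex of a path in a branch set of [q] becomes a connected branch set of [p],
    and each edge becomes an edge between two of these. *)
Lemma minor_map_comp (A B C : finType) (eA : rel A) (eB : rel B) (W : {set C})
    (eC : rel C) (p : A -> option B) (q : B -> option C) :
  minor_map eA [set: B] eB p -> minor_map eB W eC q ->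
  minor_map eA W eC (fun x => obind q (p x)).
Proof.
case=> surj conn edg [surj' conn' edg']; split.
- move=> u /surj'[b qb]; have [a pa] := surj b (in_setT _).
  by exists a; rewrite pa.
- have sub w b : q b = Some w -> subrel (connect (fiber_adj eA p b))
      (connect (fiber_adj eA (fun x => obind q (p x)) w)).
    move=> qb; apply: connect_sub => x y /and3P[xy /eqP px /eqP py].
    by apply: connect1; rewrite /fiber_adj /= xy px py /= qb eqxx.
  move=> w a a' wW; case pa: (p a) => [b|] //= qb; case pa': (p a') => [b'|] //= qb'.
  have /connectP[t] := conn' w b b' wW qb qb'.
  elim: t a b pa qb => [|c t IHt] a b pa qb /=.
    move=> _ bb; apply: (sub w b qb); apply: conn; rewrite ?inE //.
    by rewrite pa' bb.
  case/andP=> /and3P[bc _ /eqP qc] ct lt.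
  have [x [y [px py xy]]] := edg b c (in_setT _) (in_setT _) bc.
  apply: (@connect_trans _ _ x); first by apply: (sub w b qb); apply: conn; rewrite ?inE.
  apply: (@connect_trans _ _ y); last exact: IHt py qc ct lt.
  by apply: connect1; rewrite /fiber_adj /= xy px py /= qb qc eqxx.
- move=> u v uW vW /(edg' _ _ uW vW)[b [c [qb qc bc]]].
  have [x [y [px py xy]]] := edg b c (in_setT _) (in_setT _) bc.
  by exists x, y; rewrite px py.
Qed.

(* Pairs are ordered, whence the factor 6 instead of 3. *)
Definition minor_sparse (A : finType) (eA : rel A) (g : nat) : Prop :=
  forall (B : finType) (U : {set B}) (eB : rel B) (p : A -> option B),
    irreflexive eB -> minor_map eA U eB p ->
    #|[set q in setX U U | eB q.1 q.2]| <= 6 * (#|U| + g).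

Lemma minor_sparse_closed_surface (V E F A : finType) (inc0 : V -> E -> bool)
    (inc1 : F -> E -> bool) (eA : rel A) (p : V -> option A) g :
  closed_surface inc0 inc1 -> #|E| + 2 <= #|V| + #|F| + g ->
  minor_map (cell_adj inc0) [set: A] eA p -> minor_sparse eA g.
Proof.
move=> surf chi pm B U eB q irr qm.
have [U0|U0] := eqVneq U set0.
  rewrite (_ : [set _ in _ | _] = set0) ?cards0 //.
  by apply/setP=> [[x y]]; rewrite U0 !inE.
have sym0 : symmetric (cell_adj inc0).
  by move=> x y; apply: eq_existsb => e; rewrite andbC.
have [r rU rm] : exists2 r : V -> B, forall x, r x \in U
    & minor_map (cell_adj inc0) U eB (fun x => Some (r x)).
  by case: (surf) => _ _ _ con _; apply: minor_map_total (minor_map_comp pm qm).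
by apply: (card_pairs_closed_surface surf irr rU rm chi); rewrite card_gt0.
Qed.

Definition set_connected (A : finType) (eA : rel A) (S : {set A}) : Prop :=
  forall a b, a \in S -> b \in S ->
    connect [rel x y | [&& eA x y, x \in S & y \in S]] a b.

(* Branch sets [X v] only touch along the connectors [Y u v]; a maximal
   extension of the [X v] into the connectors realizes all edges. *)
Lemma minor_map_of_connectors (A B : finType) (eA : rel A) (eB : rel B)
    (X : B -> {set A}) (Y : B -> B -> {set A}) :
  symmetric eA -> symmetric eB -> irreflexive eB ->
  (forall v, X v != set0) -> (forall v, set_connected eA (X v)) ->
  (forall u v, eB u v -> set_connected eA (Y u v)) ->
  (forall u v, eB u v -> Y u v :&: X u != set0 /\ Y u v :&: X v != set0) ->
  (forall u v, u != v -> [disjoint X u & X v]) ->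
  (forall u v w, eB u v -> w != u -> w != v -> [disjoint Y u v & X w]) ->
  (forall u v u' v', eB u v -> eB u' v' -> [set u; v] != [set u'; v'] ->
     [disjoint Y u v & Y u' v']) ->
  exists p : A -> option B, minor_map eA [set: B] eB p.
Proof.
move=> symA symB irrB X0 Xc Yc YX XX YXd YYd.
pose good (p : A -> option B) :=
  [/\ forall v a, a \in X v -> p a = Some v,
      forall v a, p a = Some v -> a \in X v \/ exists2 w, eB v w & a \in Y v w \/ a \in Y w v
    & forall v a, p a = Some v -> exists2 x, x \in X v & connect (fiber_adj eA p v) a x].
have fsym p v : connect_sym (fiber_adj eA p v).
  by apply: sym_connect_sym => a b; rewrite /fiber_adj /= symA [(p a == _) && _]andbC.
have good0 : good (fun a => [pick v | a \in X v]).
  have pX v a : a \in X v -> [pick v | a \in X v] = Some v.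
    move=> av; case: pickP => [w aw|/(_ v)]; last by rewrite av.
    have [->//|wv] := eqVneq w v; move/pred0P/(_ a): (XX w v wv); by rewrite /= aw av.
  have Xp v a : [pick v | a \in X v] = Some v -> a \in X v.
    by case: pickP => // w aw [<-].
  split=> [//|v a /Xp|v a /Xp av]; [by left | by exists a; rewrite ?connect0].
suff step k : forall p, good p -> #|[set a | p a == None]| < k ->
    exists q : A -> option B, minor_map eA [set: B] eB q.
  exact: step _ _ good0 (ltnSn _).
elim: k => // k IHk p gp ltk; case: (gp) => pX Xp pc.
have [all_real|] := boolP [forall u, forall v, eB u v ==>
  [exists a, exists b, [&& p a == Some u, p b == Some v & eA a b]]].
  exists p; split=> [v _ | v a b _ pa pb | u v _ _ uv].
  - by have /set0Pn[a av] := X0 v; exists a; apply: (pX v).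
  - have [x xv ax] := pc v a pa; have [y yv by_] := pc v b pb.
    apply: connect_trans ax _; apply: (@connect_trans _ _ y); last by rewrite fsym.
    apply: connect_sub (Xc v x y xv yv) => c d /and3P[cd cv dv]; apply: connect1.
    by rewrite /fiber_adj /= cd (pX v c cv) (pX v d dv) eqxx.
  - have /forallP/(_ v) := forallP all_real u; rewrite uv /= => /existsP[a /existsP[b]].
    by case/and3P=> /eqP pa /eqP pb ab; exists a, b.
case/forallPn=> u /forallPn[v]; rewrite negb_imply => /andP[uv no].
have uNv : u != v by apply: contraTneq uv => ->; rewrite irrB.
case: (YX u v uv) => /set0Pn[a0 /setIP[a0Y a0X]] /set0Pn[b0 /setIP[b0Y b0X]].
have pa0 : a0 \in [set a | p a == Some u] by rewrite inE (pX u).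
have pb0 : b0 \notin [set a | p a == Some u].
  by rewrite inE (pX v) //; apply: contraNneq uNv => -[->].
have [a [b [aS bS /and3P[ab aY bY]]]] := connect_crossing (Yc u v uv a0 b0 a0Y b0Y) pa0 pb0.
(* [b] is where the connector leaves the branch set of [u]. Label [v] would realize the edge; any
   other label [w] would put [b] in [X w] or in a connector at [w], against disjointness. So [b] is
   free and can be given to [u]. *)
rewrite !inE in aS bS; have pbN : p b = None.
  case pb : (p b) => [w|] //; have wu : w != u by apply: contraNneq bS => <-; rewrite pb.
  have wv : w != v.
    apply: contraNneq no => wv; apply/existsP; exists a; apply/existsP; exists b.
    by rewrite aS pb wv eqxx ab.
  have ne w' : [set u; v] != [set w; w'] /\ [set u; v] != [set w'; w].
    split; apply/eqP=> /setP/(_ w); rewrite !inE eqxx ?orbT; by rewrite (negbTE wu) (negbTE wv).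
  case: (Xp w b pb) => [bw|[w' ww' bY']].
    by have /pred0P/(_ b) := YXd u v w uv wu wv; rewrite /= bY bw.
  case: bY' => bY'.
    by have /pred0P/(_ b) := YYd u v w w' uv ww' (ne w').1; rewrite /= bY bY'.
  by rewrite symB in ww'; have /pred0P/(_ b) := YYd u v w' w uv ww' (ne w').2; rewrite /= bY bY'.
pose q x := if x == b then Some u else p x.
have qp w x : p x = Some w -> q x = Some w.
  by rewrite /q; case: eqP => // ->; rewrite pbN.
have sub w : subrel (connect (fiber_adj eA p w)) (connect (fiber_adj eA q w)).
  apply: connect_sub => x y /and3P[xy /eqP px /eqP py]; apply: connect1.
  by rewrite /fiber_adj /= xy (qp w x) // (qp w y) // eqxx.
apply: (IHk q).
  split=> [w x /pX/qp //|w x|w x].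
    by rewrite /q; case: eqP => [-> [<-]|_ /Xp//]; right; exists v => //; left.
  rewrite {1}/q; case: eqP => [-> [<-]|_ px]; last first.
    by have [y yX xy] := pc w x px; exists y => //; apply: sub.
  have [y yX ay] := pc u a (eqP aS); exists y => //; apply: connect_trans (sub _ _ _ ay).
  by apply: connect1; rewrite /fiber_adj /= symA ab (qp u a (eqP aS)) /q eqxx eqxx.
rewrite -ltnS; apply: leq_trans ltk; rewrite ltnS; apply: proper_card; apply/properP; split.
  by apply/subsetP=> x; rewrite !inE /q; case: (x =P b).
by exists b; rewrite !inE ?pbN // /q eqxx.
Qed.

(** * The grid subdivision *)

(** The consequences of the link condition that the grid needs; links themselves no longer occur.
    [ps_strong] puts in inductive form that triangles are connected through shared edges. *)
Record pseudosurface (T : finType) (K : {set {set T}}) : Prop := Pseudosurface {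
  ps_nonempty : set0 \notin K;
  ps_face : forall s t : {set T}, t \in K -> s \subset t -> s != set0 -> s \in K;
  ps_dim : forall s : {set T}, s \in K -> #|s| <= 3;
  ps_edge : forall s : {set T}, s \in K -> #|s| = 2 ->
    #|[set t in K | (#|t| == 3) && (s \subset t)]| = 2;
  ps_connected : forall x y, [set x] \in K -> [set y] \in K ->
    connect [rel a b | [set a; b] \in K] x y;
  ps_strong : forall (A : {set {set T}}) t0,
    t0 \in K -> #|t0| = 3 -> t0 \in A ->
    (forall s t t' : {set T}, s \in K -> #|s| = 2 -> s \subset t -> s \subset t' ->
       t \in K -> t' \in K -> #|t| = 3 -> #|t'| = 3 -> t \in A -> t' \in A) ->
    forall t, t \in K -> #|t| = 3 -> t \in A }.

Lemma card_sub_set (T : finType) (P : pred T) (S : subFinType P) (Q : pred T) :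
  #|[set x : S | Q (val x)]| = #|[set a | P a && Q a]|.
Proof.
rewrite -(card_imset _ val_inj); apply: eq_card => a; rewrite !inE.
apply/imsetP/andP=> [[x]|[Pa Qa]].
  by rewrite inE => Qx ->; rewrite (valP x).
by exists (Sub a Pa); rewrite ?inE SubK.
Qed.

(* The grid subdivision of [K], each edge being cut into [n] pieces: the
   vertices are the points with barycentric coordinates [a / n]. *)
Section Grid.
Variables (T : finType) (K : {set {set T}}) (n : nat).

Definition vec := {ffun T -> 'I_n.+1}.
Implicit Types (a b c m : vec) (s t A : {set T}).

Definition wt a : nat := \sum_x a x.
Definition vsupp a : {set T} := [set x | 0 < a x].
(** [inord] turns an overflow into 0, whence the condition [m x < n] in the lemmas on [vadd]; [vsub]
    truncates at 0. *)
Definition vadd m x : vec := [ffun y => inord (m y + (y == x))].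
Definition vsub m x : vec := [ffun y => inord (m y - (y == x))].

Definition vertex_cell : pred vec := [pred a | (wt a == n) && (vsupp a \in K)].
(* [(m, {i, j})] is the edge from [m + e_i] to [m + e_j]. *)
Definition edge_cell : pred (vec * {set T}) :=
  [pred q : vec * {set T} | [&& (wt q.1).+1 == n, #|q.2| == 2 & vsupp q.1 :|: q.2 \in K]].
(* [(c, s, true)] is the triangle with vertices [c + e_i], and [(c, s, false)]
   the triangle with vertices [c + e_i + e_j], for distinct [i, j] in [s]. *)
Definition face_cell : pred (vec * {set T} * bool) :=
  [pred q : vec * {set T} * bool | [&& #|q.1.2| == 3, q.1.2 \in K, vsupp q.1.1 \subset q.1.2
              & (if q.2 then (wt q.1.1).+1 else (wt q.1.1).+2) == n]].

Definition grid_vertex := {a | vertex_cell a}.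
Definition grid_edge := {q | edge_cell q}.
Definition grid_face := {q | face_cell q}.

Definition end_of a (q : vec * {set T}) := [exists i in q.2, a == vadd q.1 i].
Definition side_of (f : vec * {set T} * bool) (q : vec * {set T}) :=
  if f.2 then (q.1 == f.1.1) && (q.2 \subset f.1.2)
  else [exists i in f.1.2, q == (vadd f.1.1 i, f.1.2 :\ i)].

Definition grid_end (x : grid_vertex) (e : grid_edge) := end_of (val x) (val e).
Definition grid_side (f : grid_face) (e : grid_edge) := side_of (val f) (val e).

Lemma vecP a b : (forall x, a x = b x :> nat) -> a = b.
Proof. by move=> ab; apply/ffunP=> x; apply: val_inj; apply: ab. Qed.

Lemma vsubE m x y : vsub m x y = m y - (y == x) :> nat.
Proof. by rewrite ffunE inordK // ltnS (leq_trans (leq_subr _ _)) // -ltnS. Qed.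

Lemma vaddE m x y : m x < n -> vadd m x y = m y + (y == x) :> nat.
Proof.
move=> mx; rewrite ffunE inordK //; case: eqP => [->|_]; first by rewrite addn1 ltnS.
by rewrite addn0.
Qed.

Lemma leq_wt m x : m x <= wt m.
Proof. by rewrite /wt (bigD1 x) //= leq_addr. Qed.

Lemma wt_lt m x : (wt m).+1 <= n -> m x < n.
Proof. by apply: leq_ltn_trans; apply: leq_wt. Qed.

Lemma wt_vadd m x : m x < n -> wt (vadd m x) = (wt m).+1.
Proof.
move=> mx; rewrite /wt (bigD1 x) //= vaddE // eqxx (bigD1 x (P := xpredT)) //=.
rewrite addn1 addSn; congr (_ + _).+1; apply: eq_bigr => y /negbTE yx.
by rewrite vaddE // yx addn0.
Qed.

Lemma vsubK m x : 0 < m x -> vadd (vsub m x) x = m.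
Proof.
move=> mx; apply: vecP => y; have ltx := ltn_ord (m x).
rewrite vaddE vsubE ?eqxx; last lia.
by case: eqP => [->|_]; lia.
Qed.

Lemma vaddK m x : m x < n -> vsub (vadd m x) x = m.
Proof. by move=> mx; apply: vecP => y; rewrite vsubE vaddE // addnK. Qed.

Lemma wt_vsub m x : 0 < m x -> (wt (vsub m x)).+1 = wt m.
Proof.
move=> mx; rewrite -(@wt_vadd _ x) ?vsubK // vsubE eqxx.
by have := ltn_ord (m x); lia.
Qed.

Lemma vsupp_vadd m x : m x < n -> vsupp (vadd m x) = x |: vsupp m.
Proof.
by move=> mx; apply/setP=> y; rewrite !inE vaddE //; case: eqP => _; rewrite ?addn1 ?addn0.
Qed.

Lemma vsupp_vsub m x : vsupp (vsub m x) \subset vsupp m.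
Proof. by apply/subsetP=> y; rewrite !inE vsubE; lia. Qed.

Lemma vadd_inj m x y : m x < n -> m y < n -> vadd m x = vadd m y -> x = y.
Proof.
move=> mx my /ffunP/(_ x)/(congr1 val) /=; rewrite !vaddE // eqxx.
by case: eqP => //; lia.
Qed.

Hypothesis psK : pseudosurface K.

Lemma vertex_cell_vadd m A i : edge_cell (m, A) -> i \in A -> vertex_cell (vadd m i).
Proof.
case/and3P=> /= /eqP wm _ SK iA; have mi : m i < n by apply: wt_lt; rewrite wm.
rewrite /vertex_cell /= wt_vadd // wm eqxx /= vsupp_vadd //.
apply: ps_face SK _ _ => //; last by apply/set0Pn; exists i; rewrite setU11.
by rewrite subUset subsetUl sub1set inE iA orbT.
Qed.

Lemma grid_ends e : #|[set x | grid_end x e]| = 2.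
Proof.
case: e => -[m A] eP; rewrite /grid_end /= (card_sub_set _ (fun a => end_of a (m, A))).
case/and3P: (eP) => /= /eqP wm /cards2P[i [j [ij AE]]] SK.
have lt x : m x < n by apply: wt_lt; rewrite wm.
rewrite (_ : [set _ | _] = [set vadd m i; vadd m j]); last first.
  apply/setP=> a; rewrite !inE; apply/andP/idP=> [[_ /exists_inP[x /= xA /eqP->]]|].
    by move: xA; rewrite AE => /set2P[]->; rewrite eqxx ?orbT.
  case/orP=> /eqP->; (split; first by apply: vertex_cell_vadd eP _; rewrite AE !inE eqxx ?orbT).
    by apply/exists_inP; exists i; rewrite //= AE !inE eqxx.
  by apply/exists_inP; exists j; rewrite //= AE !inE eqxx orbT.
by rewrite cards2; case: eqP => // /vadd_inj E; rewrite E ?eqxx in ij.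
Qed.

(** If [m] is supported in [A], the edge lies on the edge [A] of [K] and its sides are upward
    triangles, one in each of the two triangles of [K] on [A]. Otherwise it is interior to the
    triangle [k |: A], with one upward and one downward side. *)
Lemma grid_sides e : #|[set f | grid_side f e]| = 2.
Proof.
case: e => -[m A] eP; rewrite /grid_side /= (card_sub_set _ (fun f => side_of f (m, A))).
case/and3P: (eP) => /= /eqP wm /eqP cA SK.
have lt x : m x < n by apply: wt_lt; rewrite wm.
have A0 : A != set0 by rewrite -card_gt0 cA.
have [mA|mA] := boolP (vsupp m \subset A).
  have AK : A \in K by move: SK; rewrite (setUidPr mA).
  rewrite -(ps_edge psK AK cA).
  rewrite -(card_imset _ (f := fun t => (m, t, true))); last by move=> t t' [].
  apply: eq_card => -[[c s] b]; rewrite !inE /=.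
  apply/andP/imsetP=> [[/and4P[/= cs sK sc wc] si]|[t]]; last first.
    rewrite inE => /and3P[tK ct At] [-> -> ->].
    by rewrite /face_cell /side_of /= ct tK (subset_trans mA At) wm !eqxx At; split.
  case: b wc si => /= [wc|wc]; rewrite /side_of /=.
    case/andP=> /eqP-> As; exists s => //; by rewrite !inE sK cs.
  case/exists_inP=> i is_ /eqP[mE AE]; have ci : c i < n by apply: wt_lt; rewrite -(eqP wc).
  move/subsetP: mA => /(_ i); rewrite mE vsupp_vadd // !inE eqxx /= => /(_ isT).
  by rewrite AE !inE eqxx.
have /subsetPn[k kS kA] := mA.
have mk : 0 < m k by move: kS; rewrite inE.
have SE : vsupp m :|: A = k |: A.
  apply/esym/eqP; rewrite eqEcard cardsU1 kA cA (ps_dim psK) // andbT.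
  by rewrite subUset subsetUr sub1set inE kS.
rewrite SE in SK.
have c3 : #|k |: A| = 3 by rewrite cardsU1 kA cA.
have mSub : vsupp m \subset k |: A by rewrite -SE subsetUl.
rewrite (_ : [set _ | _] = [set (m, k |: A, true); (vsub m k, k |: A, false)]).
  by rewrite cards2; case: eqP => // -[].
apply/setP=> -[[c s] b]; rewrite !inE /=; apply/andP/idP; last first.
  case/orP=> /eqP[-> -> ->]; rewrite /face_cell /side_of /= c3 SK /= ?mSub ?wm ?eqxx ?subsetUr //.
  rewrite (subset_trans (vsupp_vsub m k)) // wt_vsub // wm eqxx; split=> //.
  by apply/exists_inP; exists k; rewrite ?setU11 // vsubK // setU1K.
case=> /and4P[/= cs sK sc wc]; rewrite /side_of /=; case: b wc => /= wc.
  case/andP=> /eqP mE As; apply/orP; left; apply/eqP; congr (_, _, _) => //.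
  rewrite -mE in sc.
  by apply/eqP; rewrite eq_sym eqEcard c3 (eqP cs) leqnn andbT -SE subUset sc As.
case/exists_inP=> i is_ /eqP[mE AE]; have ci : c i < n by apply: wt_lt; rewrite -(eqP wc).
apply/orP; right.
have sE : s = i |: A by rewrite AE setD1K.
have ki : k = i.
  move: kS; rewrite mE vsupp_vadd // => /setU1P[//|/(subsetP sc) ks].
  by move: kA; rewrite AE !inE ks andbT negbK => /eqP.
by rewrite ki sE mE vaddK.
Qed.

Lemma cards3E s i : #|s| = 3 -> i \in s ->
  exists j k, [/\ i != j, i != k, j != k & s = [set i; j; k]].
Proof.
move=> s3 is_; have : #|s :\ i| == 2 by rewrite -(eqn_add2l (i \in s)) -cardsD1 s3 is_.
case/cards2P=> j [k [jk E]].
have := set21 j k; rewrite -E !inE => /andP[ji js].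
have := set22 j k; rewrite -E !inE => /andP[ki ks].
by exists j, k; rewrite -setUA -E setD1K // ![i == _]eq_sym ji ki jk.
Qed.

(** A grid vertex is either no corner of the triangle or lies on exactly two of its three sides. *)
Lemma grid_degree_even x f : ~~ odd #|[set e | grid_end x e && grid_side f e]|.
Proof.
case: x => a aP; case: f => -[[c s] b] fP; rewrite /grid_end /grid_side /=.
rewrite (card_sub_set _ (fun q => end_of a q && side_of (c, s, b) q)).
set D := [set _ | _].
suff [->|->] : #|D| = 0 \/ #|D| = 2 by [].
have [D0|[q0 q0D]] := set_0Vmem D; first by left; rewrite D0 cards0.
right; case/and4P: fP => /= cs sK sc; rewrite /D /side_of /= {D} in q0D *.
case: b q0D => /= q0D /eqP wc.
  have lt x : c x < n by apply: wt_lt; rewrite wc.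
  have [i is_ aE] : exists2 i, i \in s & a = vadd c i.
    move: q0D; rewrite inE => /andP[_ /andP[/exists_inP[i iq /eqP aE] /andP[/eqP qc qs]]].
    by exists i; [exact: (subsetP qs)|rewrite aE qc].
  have [j [k [ij ik jk sE]]] := cards3E (eqP cs) is_.
  rewrite (_ : [set _ | _] = [set (c, [set i; j]); (c, [set i; k])]).
    rewrite cards2; case: eqP => // -[/setP/(_ j)].
    by rewrite !inE eqxx orbT (eq_sym j) (negbTE ij) (negbTE jk).
  apply/setP=> -[m A]; rewrite !inE /=; apply/andP/idP.
    case=> /and3P[/= _ cA _] /andP[/exists_inP[i' /= i'A /eqP]] + /andP[/eqP mE As].
    rewrite mE aE => /vadd_inj ii; rewrite -ii // in i'A.
    have [l lE] : exists l, A = [set i; l].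
      case/cards2P: cA i'A => x [y [_ ->]] /set2P[]->; first by exists y.
      by exists x; rewrite setUC.
    have := subsetP As l; rewrite lE set22 => /(_ isT); rewrite sE !inE.
    case/orP=> [/orP[]|] /eqP l'; rewrite l'.
    + by move: cA; rewrite lE l' cards2 eqxx.
    + by rewrite eqxx.
    + by rewrite eqxx orbT.
  have oP (B : {set T}) : #|B| = 2 -> i \in B -> B \subset s ->
    edge_cell (c, B) /\ end_of a (c, B) && ((c == c) && (B \subset s)).
    move=> cB iB Bs; split; last first.
      by rewrite eqxx Bs !andbT /end_of; apply/exists_inP; exists i; rewrite //= aE.
    rewrite /edge_cell /= wc cB !eqxx /=; apply: (ps_face psK sK).
      by rewrite subUset sc.
    by apply/set0Pn; exists i; rewrite inE iB orbT.
  by case/orP=> /eqP[-> ->]; apply: oP;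
    rewrite ?cards2 ?ij ?ik ?set21 // sE subUset !sub1set !inE !eqxx ?orbT.
have lt x : c x < n by apply: wt_lt; rewrite -wc.
have lt2 x y : vadd c x y < n by apply: wt_lt; rewrite wt_vadd // wc.
have [i [j [is_ js ji aE]]] : exists i j, [/\ i \in s, j \in s, j != i & a = vadd (vadd c i) j].
  move: q0D; rewrite inE => /andP[_ /andP[/exists_inP[j jq /eqP aE] /exists_inP[i is_ /eqP qE]]].
  by exists i, j; move: jq; rewrite aE qE !inE /= => /andP[-> ->].
have [j' [k [ij' ik j'k sE']]] := cards3E (eqP cs) is_.
have [l [il jl sE]] : exists l, [/\ l != i, l != j & s = [set i; j; l]].
  move: js; rewrite sE' !inE (negbTE ji) /= => /orP[]/eqP->.
    by exists k; rewrite ![k == _]eq_sym.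
  exists j'; rewrite [j' == i]eq_sym; split=> //.
  by rewrite -!setUA; congr (_ :|: _); rewrite setUC.
have aE' : a = vadd (vadd c j) i.
  by rewrite aE; apply: vecP => x; rewrite !(vaddE _ (lt2 _ _)) !(vaddE _ (lt _)) addnAC.
rewrite (_ : [set _ | _] = [set (vadd c i, s :\ i); (vadd c j, s :\ j)]).
  rewrite cards2; case: eqP => // -[/vadd_inj E]; move: ji.
  by rewrite E ?eqxx.
apply/setP=> -[m A]; rewrite !inE /=; apply/andP/idP.
  case=> _ /andP[/exists_inP[y /= yA /eqP ay] /exists_inP[x xs /eqP[mE AE]]].
  rewrite mE AE; move: (xs); rewrite sE !inE => /orP[/orP[]|] /eqP xE.
  + by rewrite xE eqxx.
  + by rewrite xE eqxx orbT.
  (* The third side is excluded by the coordinate [l]: both its ends exceed [c] there, whereas [a]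
     agrees with [c]. *)
  have := congr1 (fun v : vec => v l : nat) aE; rewrite ay mE xE /= !(vaddE _ (lt2 _ _)) !(vaddE _ (lt _)) eqxx.
  by rewrite (negbTE il) (negbTE jl) !addn0 -addnA => /eqP; rewrite -[X in _ == X]addn0 eqn_add2l.
have oP x y : x \in s -> y \in s -> y != x -> a = vadd (vadd c x) y ->
    edge_cell (vadd c x, s :\ x) /\ end_of a (vadd c x, s :\ x) &&
    [exists i in s, (vadd c x, s :\ x) == (vadd c i, s :\ i)].
  move=> xs ys yx axy; split; last first.
    apply/andP; split; last by apply/exists_inP; exists x.
    by rewrite /end_of; apply/exists_inP; exists y; rewrite /= ?axy // !inE yx.
  have cx : #|s :\ x| == 2 by rewrite -(eqn_add2l (x \in s)) -cardsD1 (eqP cs) xs.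
  rewrite /edge_cell /= wt_vadd // wc cx eqxx /=; apply: ps_face sK _ _ => //.
    by rewrite vsupp_vadd // !subUset sc sub1set xs subD1set.
  by apply/set0Pn; exists y; rewrite !inE yx ys orbT.
case/orP=> /eqP[-> ->]; first exact: (oP i j).
by apply: (oP j i); rewrite // eq_sym.
Qed.


(** * Connectivity of the grid *)

Lemma grid_vertex_adj (x y : grid_vertex) m i j :
  val x = vadd m i -> val y = vadd m j -> i != j -> edge_cell (m, [set i; j]) ->
  cell_adj grid_end x y.
Proof.
move=> xE yE ij eP; apply/existsP; exists (Sub (m, [set i; j]) eP).
by apply/andP; split; apply/exists_inP;
  [exists i | exists j]; rewrite ?SubK /= ?xE ?yE ?set21 ?set22.
Qed.

(** The inequality [wt a <= a i] is used to say that all weight sits at [i]. Not naming the total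
    lets it serve both for vertices, of weight [n], and for bases of upward triangles, of weight
    [n - 1]. *)
Lemma vsupp_corner a i : wt a <= a i -> vsupp a \subset [set i].
Proof.
move=> wi; apply/subsetP=> k; rewrite !inE => ak; apply: contraLR ak => ki.
move: wi; rewrite /wt (bigD1 i) //= (bigD1 k) //=; lia.
Qed.

Lemma corner_eq a b i : wt a <= a i -> wt b <= b i -> wt a = wt b -> a = b.
Proof.
move=> ai bi ab; have := leq_wt a i; have := leq_wt b i.
have z (v : vec) k : wt v <= v i -> k != i -> v k = 0 :> nat.
  by move/vsupp_corner/subsetP/(_ k); rewrite !inE; case: (nat_of_ord (v k)) => // x /(_ isT) ->.
move=> ib ia; apply: vecP => k; have [->|ki] := eqVneq k i; last by rewrite (z a) // (z b).
by apply/eqP; rewrite eqn_leq (leq_trans ia) ?(leq_trans ib) // ?ab // -ab.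
Qed.

Lemma off_corner a i : a i < wt a -> exists2 k, k != i & 0 < a k.
Proof.
move=> ai; apply/exists_inP; apply: contraLR ai; rewrite negb_exists_in -leqNgt.
move/forall_inP=> z; rewrite /wt (bigD1 i) //= big1 ?addn0 // => k ki.
by apply/eqP; rewrite -leqn0 leqNgt; apply: z.
Qed.

(** Moving one unit of weight from another coordinate to [i] follows a grid edge inside the same
    face of [K]; this is repeated until all weight is at [i]. *)
Lemma grid_connect_corner (x : grid_vertex) i : i \in vsupp (val x) ->
  exists2 y : grid_vertex, val y i = n :> nat & connect (cell_adj grid_end) x y.
Proof.
have [k] := ubnP (n - val x i); elim: k x => // k IHk x ltk ix.
have xP := valP x; case/andP: (xP) => /= /eqP wx sx.
have [xi|xi] := eqVneq (val x i : nat) n; first by exists x.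
have ltin : val x i < n by rewrite ltn_neqAle xi -ltnS ltn_ord.
have lti : val x i < wt (val x) by rewrite wx.
have [j ji xj] := off_corner lti; set m := vsub (val x) j.
have wm : (wt m).+1 = n by rewrite wt_vsub.
have eP : edge_cell (m, [set j; i]).
  rewrite /edge_cell /= wm eqxx cards2 ji /=; apply: (ps_face psK sx).
    rewrite !subUset !sub1set vsupp_vsub ix inE andbT; exact: xj.
  by apply/set0Pn; exists i; rewrite !inE eqxx !orbT.
have mi : m i < n by apply: wt_lt; rewrite wm.
have yP : vertex_cell (vadd m i) by apply: vertex_cell_vadd eP _; rewrite set22.
pose y : grid_vertex := Sub _ yP.
have yi : val y i = (val x i).+1 :> nat.
  by rewrite SubK vaddE // vsubE eqxx eq_sym (negbTE ji) subn0 addn1.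
have [||z zi yz] := IHk y.
- by rewrite yi subnS prednK ?subn_gt0 // -ltnS.
- by rewrite inE yi.
exists z => //; apply: connect_trans yz; apply: connect1.
by apply: (@grid_vertex_adj _ _ m j i) => //; rewrite /m ?vsubK.
Qed.

Lemma cell_adj_sym (X J : finType) (inc : X -> J -> bool) : connect_sym (cell_adj inc).
Proof. by apply: sym_connect_sym => x y; apply: eq_existsb => e; rewrite andbC. Qed.

Hypothesis n0 : 0 < n.

Lemma grid_vertex_connected x y : connect (cell_adj grid_end) x y.
Proof.
have ex (z : grid_vertex) : exists i, i \in vsupp (val z).
  case/andP: (valP z) => _ sz; apply/set0Pn.
  by apply: contraTneq sz => ->; apply: ps_nonempty.
have corner (z : grid_vertex) i : val z i = n :> nat -> wt (val z) <= val z i.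
  by move=> ->; case/andP: (valP z) => /eqP->.
have single (z : grid_vertex) i : i \in vsupp (val z) -> [set i] \in K.
  move=> iz; case/andP: (valP z) => _ sz; apply: (ps_face psK sz).
    by rewrite sub1set.
  by rewrite -card_gt0 cards1.
have [i ix] := ex x; have [j jy] := ex y.
have [u ui xu] := grid_connect_corner ix; have [v vj yv] := grid_connect_corner jy.
apply: connect_trans xu _; apply: (@connect_trans _ _ v); last by rewrite cell_adj_sym.
have /connectP[p] := ps_connected psK (single _ _ ix) (single _ _ jy).
elim: p i u ui {ix x} => [|k p IHp] i u ui /=.
  move=> _ ij; suff -> : u = v by [].
  apply: val_inj; rewrite ij in vj; apply: (corner_eq (corner _ _ ui) (corner _ _ vj)).
  by case/andP: (valP u) (valP v) => /eqP-> _ /andP[/eqP-> _].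
case/andP=> ikK kp lst.
have [ik|ik] := eqVneq i k; first by apply: (IHp k u) => //; rewrite -ik.
case/andP: (valP u) => /= /eqP wu su; have u0 : 0 < val u i by rewrite ui.
have wm : (wt (vsub (val u) i)).+1 = n by rewrite wt_vsub.
(* One step from the corner at [i] along the edge of [K] makes coordinate [k] positive, and from
   there the corner at [k] can be reached. *)
have eP : edge_cell (vsub (val u) i, [set i; k]).
  rewrite /edge_cell /= wm eqxx cards2 ik /= (setUidPr _) //.
  apply: subset_trans (vsupp_vsub _ _) (subset_trans (vsupp_corner (corner _ _ ui)) _).
  by rewrite sub1set set21.
have mk : vsub (val u) i k < n by apply: wt_lt; rewrite wm.
have zP : vertex_cell (vadd (vsub (val u) i) k).
  by apply: vertex_cell_vadd eP _; rewrite set22.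
pose z : grid_vertex := Sub _ zP.
have kz : k \in vsupp (val z) by rewrite SubK vsupp_vadd // setU11.
have [w wk zw] := grid_connect_corner kz.
apply: connect_trans (IHp k w wk kp lst); apply: connect_trans zw; apply: connect1.
by apply: (@grid_vertex_adj _ _ (vsub (val u) i) i k) => //; rewrite vsubK.
Qed.

Lemma grid_face_adj (f g : grid_face) c s i :
  val f = (c, s, false) -> val g = (vadd c i, s, true) -> i \in s ->
  cell_adj grid_side f g.
Proof.
move=> fE gE is_; have := valP f; rewrite fE => /and4P[/= cs sK sc /eqP wc].
have ci : c i < n by apply: wt_lt; rewrite -wc.
have c2 : #|s :\ i| == 2 by rewrite -(eqn_add2l (i \in s)) -cardsD1 (eqP cs) is_.
have eP : edge_cell (vadd c i, s :\ i).
  rewrite /edge_cell /= wt_vadd // wc eqxx c2 vsupp_vadd //=; apply: (ps_face psK sK).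
    by rewrite !subUset sub1set is_ sc subD1set.
  by apply/set0Pn; exists i; rewrite !inE eqxx.
apply/existsP; exists (Sub _ eP); rewrite /grid_side /side_of fE gE /= eqxx subD1set.
by rewrite ?andbT; apply/exists_inP; exists i.
Qed.

(** An upward triangle at [c] passes to the one at [c - e_j + e_i] through the downward triangle at
    [c - e_j], which gains weight at [i]. A downward triangle first steps to an upward neighbor. *)
Lemma grid_face_corner (f : grid_face) i : i \in (val f).1.2 ->
  exists c (g : grid_face), [/\ val g = (c, (val f).1.2, true), wt c <= c i,
    (wt c).+1 = n & connect (cell_adj grid_side) f g].
Proof.
have up (h : grid_face) c s : val h = (c, s, true) -> i \in s ->
    exists c' (g : grid_face), [/\ val g = (c', s, true), wt c' <= c' i,
      (wt c').+1 = n & connect (cell_adj grid_side) h g].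
  have [k] := ubnP (n - c i); elim: k c h => // k IHk c h ltk hE is_.
  have := valP h; rewrite hE => /and4P[/= cs sK sc /eqP wc].
  have [ci|ci] := leqP (wt c) (c i); first by exists c, h.
  have [j ji cj] := off_corner ci.
  have js : j \in s by rewrite (subsetP sc) // inE.
  have w1 := wt_vsub cj; have ij : vsub c j i < n by apply: wt_lt; lia.
  have dP : face_cell (vsub c j, s, false).
    by rewrite /face_cell /= cs sK (subset_trans (vsupp_vsub c j)) //= w1 wc.
  have uP : face_cell (vadd (vsub c j) i, s, true).
    rewrite /face_cell /= cs sK wt_vadd // w1 wc vsupp_vadd // subUset sub1set is_.
    by rewrite (subset_trans (vsupp_vsub c j)) /=.
  pose d : grid_face := Sub _ dP; pose u : grid_face := Sub _ uP.
  have [|//|//|c' [g [gE ci' wc' ug]]] := IHk (vadd (vsub c j) i) u.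
    by rewrite vaddE // vsubE eqxx eq_sym (negbTE ji); lia.
  exists c', g; split=> //; apply: connect_trans ug.
  apply: (@connect_trans _ _ d).
    rewrite cell_adj_sym; apply: connect1; apply: (@grid_face_adj d h (vsub c j) s j) => //.
    by rewrite vsubK.
  by apply: connect1; apply: (@grid_face_adj d u (vsub c j) s i).
case fE: (val f) => [[c s] b] /= is_; case: b fE => fE; first exact: up fE is_.
have := valP f; rewrite fE => /and4P[/= cs sK sc /eqP wc].
have ci : c i < n by apply: wt_lt; rewrite -wc.
have uP : face_cell (vadd c i, s, true).
  by rewrite /face_cell /= cs sK wt_vadd // wc vsupp_vadd // subUset sub1set is_ sc eqxx.
pose u : grid_face := Sub _ uP.
have [//|//|c' [g [gE ci' wc' ug]]] := up u (vadd c i) s.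
exists c', g; split=> //; apply: connect_trans ug.
by apply: connect1; apply: (grid_face_adj fE).
Qed.

(** All small triangles in one triangle of [K] are connected to its corner triangle at a chosen
    vertex; [ps_strong] then passes from one triangle of [K] to the next. *)
Lemma grid_face_connected f g : connect (cell_adj grid_side) f g.
Proof.
pose A := [set s | [forall h : grid_face,
  ((val h).1.2 == s) ==> connect (cell_adj grid_side) f h]].
suff AP : forall r, r \in K -> #|r| = 3 -> r \in A.
  case/and4P: (valP g) => /eqP cg gK _ _.
  by have := AP _ gK cg; rewrite inE => /forallP/(_ g); rewrite eqxx.
case/and4P: (valP f) => /eqP cf fK _ _.
have same (u v : grid_face) c c' s i : val u = (c, s, true) -> val v = (c', s, true) ->
    wt c <= c i -> wt c' <= c' i -> (wt c).+1 = n -> (wt c').+1 = n -> u = v.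
  move=> uE vE ci ci' wc wc'; apply: val_inj; rewrite uE vE (corner_eq ci ci') //.
  by apply: succn_inj; rewrite wc.
apply: (ps_strong psK fK cf).
  rewrite inE; apply/forallP=> h; apply/implyP=> /eqP hf.
  have /card_gt0P[i is_] : 0 < #|(val f).1.2| by rewrite cf.
  have [c [u [uE ci wc fu]]] := grid_face_corner is_.
  rewrite -hf in is_; have [c' [v [vE ci' wc' hv]]] := grid_face_corner is_.
  rewrite hf in vE; have uv := same u v _ _ _ _ uE vE ci ci' wc wc'.
  by apply: connect_trans fu _; rewrite uv cell_adj_sym.
move=> s t t' sK s2 st st' tK t'K t3 t'3; rewrite !inE => /forallP tA.
apply/forallP=> h; apply/implyP=> /eqP ht.
have /card_gt0P[i is_] : 0 < #|s| by rewrite s2.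
have it' : i \in (val h).1.2 by rewrite ht (subsetP st').
have [c [u [uE ci wc hu]]] := grid_face_corner it'; rewrite ht in uE.
have si : vsupp c \subset s.
  by apply: subset_trans (vsupp_corner ci) _; rewrite sub1set.
have vP : face_cell (c, t, true).
  by rewrite /face_cell /= t3 tK (subset_trans si st) wc !eqxx.
pose v : grid_face := Sub _ vP.
have := tA v; rewrite SubK eqxx /= => fv; apply: connect_trans fv _.
apply: (@connect_trans _ _ u); last by rewrite cell_adj_sym.
(* The corner triangles of [t] and [t'] at the common vertex [i] share the grid edge on [s] that
   starts at the corner. *)
apply: connect1; have eP : edge_cell (c, s).
  by rewrite /edge_cell /= wc s2 (setUidPr si) sK !eqxx.
apply/existsP; exists (Sub _ eP).
by rewrite /grid_side /side_of SubK uE /= !eqxx st.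
Qed.

Lemma closed_surface_grid : closed_surface grid_end grid_side.
Proof.
split; [exact: grid_ends | exact: grid_sides | exact: grid_degree_even |
  exact: grid_vertex_connected | exact: grid_face_connected].
Qed.

(* The coordinate hypothesis holds for grid points whose stars meet. *)
Lemma grid_close_adj (x y : grid_vertex) s : #|s| <= 3 ->
  vsupp (val x) \subset s -> vsupp (val y) \subset s ->
  (forall i, val x i <= (val y i).+1) -> (forall i, val y i <= (val x i).+1) ->
  s \in K -> x = y \/ cell_adj grid_end x y.
Proof.
case: x => a aP; case: y => b bP s3; rewrite /= => sa sb ab ba sK.
case/andP: (aP) => /= /eqP wa _; case/andP: (bP) => /= /eqP wb _.
have [E|ne] := eqVneq a b; [left; exact: val_inj | right].
have lt_ex (a' b' : vec) : wt a' = n -> wt b' = n -> a' != b' -> exists i, a' i < b' i.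
  move=> wa' wb' ne'; apply/existsP; rewrite -[[exists _, _]]negbK negb_exists.
  apply: contra ne' => /forallP ge; apply/eqP/vecP => i; apply/eqP.
  rewrite eqn_leq leqNgt; have := ge i; rewrite -leqNgt => -> /=; rewrite andbT.
  apply/negP=> lt; move: wa'; rewrite -wb' /wt (bigD1 i) //= [RHS](bigD1 i) //= => E.
  have : \sum_(j | j != i) b' j <= \sum_(j | j != i) a' j.
    by apply: leq_sum => j _; have := ge j; rewrite -leqNgt.
  lia.
(* Equal weights force one coordinate [i] to drop and another [j] to rise, each by exactly one. At
   most one further coordinate is left in [s], and the total weight fixes it, so [b] is
   [a - e_i + e_j]. *)
have [j ltj] := lt_ex _ _ wa wb ne.
have [i lti] : exists i, b i < a i by apply: lt_ex; rewrite // eq_sym.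
have ij : i != j by apply: contraTneq lti => ->; rewrite -leqNgt ltnW.
have is_ : i \in s by rewrite (subsetP sa) // inE (leq_ltn_trans _ lti).
have js : j \in s by rewrite (subsetP sb) // inE (leq_ltn_trans _ ltj).
have ai : a i = (b i).+1 :> nat by apply/eqP; rewrite eqn_leq ab lti.
have bj : b j = (a j).+1 :> nat by apply/eqP; rewrite eqn_leq ba ltj.
have z k (v : vec) : vsupp v \subset s -> k \notin s -> v k = 0 :> nat.
  by move=> sv; apply: contraNeq => vk; rewrite (subsetP sv) // inE lt0n.
have same k : k != i -> k != j -> a k = b k :> nat.
  move=> ki kj; have [ks|ks] := boolP (k \in s); last by rewrite !z.
  have E : s = [set k; i; j].
    apply/esym/eqP; rewrite eqEcard; apply/andP; split.
      by apply/subsetP=> l; rewrite !inE => /orP[/orP[]|] /eqP->.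
    by rewrite -setUA cardsU1 cards2 !inE negb_or ki kj ij.
  have w (v : vec) : vsupp v \subset s -> wt v = v k + (v i + v j).
    move=> sv; rewrite /wt (bigD1 k) //= (bigD1 i) 1?eq_sym //= (bigD1 j) /=; last first.
      by rewrite ![j == _]eq_sym ij kj.
    rewrite big1 ?addn0 // => l /andP[/andP[lk li] lj].
    by apply: z => //; rewrite E !inE !negb_or lk li.
  have E2 : a i + a j = b i + b j by rewrite ai bj addSn addnS.
  by apply/eqP; rewrite -(eqn_add2r (a i + a j)) -(w a sa) E2 -(w b sb) wa wb.
have a0 : 0 < a i by rewrite ai.
have wm : (wt (vsub a i)).+1 = n by rewrite wt_vsub.
have eP : edge_cell (vsub a i, [set i; j]).
  rewrite /edge_cell /= wm eqxx cards2 ij; apply: (ps_face psK sK).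
    by rewrite !subUset !sub1set is_ js (subset_trans (vsupp_vsub a i)).
  by apply/set0Pn; exists i; rewrite !inE eqxx orbT.
apply: (@grid_vertex_adj _ _ (vsub a i) i j) => //=; first by rewrite vsubK.
have mj : vsub a i j < n by apply: wt_lt; rewrite wm.
apply: vecP => k; rewrite vaddE // vsubE.
have [->|ki] := eqVneq k i; first by rewrite (negbTE ij) ai subn1 addn0.
have [->|kj] := eqVneq k j; first by rewrite subn0 addn1.
by rewrite same // subn0 addn0.
Qed.

(** * Counting the cells of the grid *)

Definition compositions s r : {set vec} := [set a | (vsupp a \subset s) && (wt a == r)].

Definition vaddset c (B : {set T}) : vec := [ffun y => inord (c y + (y \in B))].

(** Adding one unit on each element of [B] is a bijection; the bound by [n] rules out overflow. *)
Lemma card_compositions_shift s (B : {set T}) r : B \subset s -> r + #|B| <= n ->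
  #|[set a | [&& B \subset vsupp a, vsupp a \subset s & wt a == r + #|B|]]|
    = #|compositions s r|.
Proof.
move=> Bs rn.
have ltc c y : wt c = r -> c y + (y \in B) <= n.
  move=> wc; apply: leq_trans rn; apply: leq_add; first by rewrite -wc leq_wt.
  by case: (boolP (y \in B)) => // yB; rewrite (cardD1 y) yB.
have addE c y : wt c = r -> vaddset c B y = c y + (y \in B) :> nat.
  by move=> wc; rewrite ffunE inordK // ltnS ltc.
rewrite -(@card_in_imset _ _ (fun c => vaddset c B) (mem (compositions s r))).
  apply: eq_card => a; rewrite inE; apply/and3P/imsetP; last first.
    case=> c; rewrite inE => /andP[sc /eqP wc] ->; split.
    - by apply/subsetP=> y yB; rewrite inE addE // yB addn1.
    - apply/subsetP=> y; rewrite inE addE //; case: (boolP (y \in B)) => [/(subsetP Bs)//|_].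
      by rewrite addn0 => cy; apply: (subsetP sc); rewrite inE.
    - apply/eqP; rewrite /wt (eq_bigr _ (fun y _ => addE c y wc)) big_split /=.
      by rewrite -{1}wc -sum1_card [in RHS]big_mkcond.
  case=> Ba sa /eqP wa; pose c : vec := [ffun y => inord (a y - (y \in B))].
  have cE y : c y = a y - (y \in B) :> nat.
    by rewrite ffunE inordK // ltnS (leq_trans (leq_subr _ _)) // -ltnS.
  have acE y : c y + (y \in B) = a y.
    rewrite cE subnK //; case: (boolP (y \in B)) => // /(subsetP Ba).
    by rewrite inE.
  have wc : wt c = r.
    apply/eqP; rewrite -(eqn_add2r #|B|) -wa /wt -sum1_card [X in _ + X]big_mkcond /=.
    by rewrite -big_split /=; apply/eqP/eq_bigr => y _; rewrite -acE.
  exists c; last by apply: vecP => y; rewrite addE // acE.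
  rewrite inE wc eqxx andbT; apply: subset_trans sa; apply/subsetP=> y.
  by rewrite !inE cE => cy; apply: leq_trans cy (leq_subr _ _).
move=> c c'; rewrite !inE => /andP[_ /eqP wc] /andP[_ /eqP wc'] /ffunP E; apply: vecP => y.
by have /(congr1 val) /= := E y; rewrite !addE // => /addIn.
Qed.

(** Pascal's rule: either coordinate [k] vanishes or one unit can be removed from it. *)
Lemma card_compositionsS s k r : k \in s -> r < n ->
  #|compositions s r.+1| = #|compositions (s :\ k) r.+1| + #|compositions s r|.
Proof.
move=> ks rn; rewrite -(cardsID [set a : vec | 0 < a k]) addnC; congr (_ + _).
  apply: eq_card => a; rewrite !inE subsetD1 inE.
  by case: (0 < a k); rewrite ?andbF ?andbT.
rewrite -(@card_compositions_shift s [set k]) ?sub1set ?cards1 ?addn1 //.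
by apply: eq_card => a; rewrite !inE sub1set inE andbC.
Qed.

Lemma card_compositions0 s : #|compositions s 0| = 1.
Proof.
pose z : vec := [ffun=> ord0]; rewrite (_ : compositions s 0 = [set z]) ?cards1 //.
apply/setP=> a; rewrite !inE; apply/andP/eqP=> [[_ /eqP w0]|->].
  by apply: vecP => y; rewrite ffunE; apply/eqP; rewrite -leqn0 -w0 leq_wt.
split; first by apply/subsetP=> y; rewrite !inE ffunE.
by apply/eqP/big1 => y _; rewrite ffunE.
Qed.

Lemma card_compositions_set0 r : #|compositions set0 r.+1| = 0.
Proof.
apply/eqP; rewrite cards_eq0; apply/eqP/setP=> a; rewrite !inE subset0.
apply/negbTE/negP=> /andP[/eqP/setP a0 /eqP w]; suff : wt a = 0 by rewrite w.
by apply: big1 => y _; apply/eqP; rewrite -leqn0 leqNgt; have := a0 y; rewrite !inE => ->.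
Qed.

Lemma card_compositions_cards1 s r : #|s| = 1 -> r <= n -> #|compositions s r| = 1.
Proof.
move/eqP/cards1P=> [k ->]; elim: r => [|r IHr] rn; first exact: card_compositions0.
by rewrite (card_compositionsS (set11 k)) // setDv card_compositions_set0 IHr // ltnW.
Qed.

Lemma card_compositions_cards2 s r : #|s| = 2 -> r <= n -> #|compositions s r| = r.+1.
Proof.
move=> s2; have /card_gt0P[k ks] : 0 < #|s| by rewrite s2.
have s1 : #|s :\ k| = 1 by apply/eqP; rewrite -(eqn_add2l (k \in s)) -cardsD1 s2 ks.
elim: r => [|r IHr] rn; first exact: card_compositions0.
by rewrite (card_compositionsS ks) // IHr 1?ltnW // card_compositions_cards1.
Qed.

Lemma card_compositions_cards3 s r : #|s| = 3 -> r <= n ->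
  #|compositions s r| = 'C(r.+2, 2).
Proof.
move=> s3; have /card_gt0P[k ks] : 0 < #|s| by rewrite s3.
have s2 : #|s :\ k| = 2 by apply/eqP; rewrite -(eqn_add2l (k \in s)) -cardsD1 s3 ks.
elim: r => [|r IHr] rn; first exact: card_compositions0.
rewrite (card_compositionsS ks) // IHr 1?ltnW // card_compositions_cards2 //.
by rewrite [in RHS]binS bin1 addnC.
Qed.

Definition faces_of_size k := #|[set s in K | #|s| == k]|.

Lemma sum_by_size (F : nat -> nat) : \sum_(s in K) F #|s| =
  faces_of_size 1 * F 1 + faces_of_size 2 * F 2 + faces_of_size 3 * F 3.
Proof.
have E k : faces_of_size k * F k = \sum_(s in K) (#|s| == k) * F k.
  rewrite -big_distrl /=; congr (_ * _).
  by rewrite /faces_of_size -sum1dep_card big_mkcondr.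
rewrite !E -!big_split /=; apply: eq_bigr => s sK.
have := ps_dim psK sK; have : 0 < #|s|.
  by rewrite card_gt0; apply: contraTneq sK => ->; apply: ps_nonempty.
by case: #|s| => [|[|[|[|?]]]] //= _ _; rewrite !mul1n !mul0n ?addn0.
Qed.

(** Vertices are grouped by the open face [s] containing them; [2 < n] makes [n - #|s|] a true
    subtraction. *)
Lemma card_grid_vertex : 2 < n ->
  #|{: grid_vertex}| = \sum_(s in K) #|compositions s (n - #|s|)|.
Proof.
move=> n3; rewrite card_sig -sum1_card (partition_big vsupp (mem K)) /=; last first.
  by move=> a /andP[].
apply: eq_bigr => s sK; rewrite sum1dep_card -(@card_compositions_shift s s) //.
  apply: eq_card => a; rewrite !inE subnK; last by apply: leq_trans (ps_dim psK sK) _.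
  rewrite /vertex_cell /= andbA -eqEsubset (eq_sym s).
  by case: (vsupp a =P s) => [->|_]; rewrite ?andbF ?andbT // sK andbT.
by rewrite subnK //; apply: leq_trans (ps_dim psK sK) _.
Qed.

(** Edges are grouped by [s], the union of the support of the base with [A]. The base has weight
    [n - 1] and must be positive on the [#|s| - 2] elements of [s] outside [A], leaving
    [n + 1 - #|s|] free units. *)
Lemma card_grid_edge : 2 < n ->
  #|{: grid_edge}| = \sum_(s in K) 'C(#|s|, 2) * #|compositions s (n.+1 - #|s|)|.
Proof.
move=> n3; rewrite card_sig -sum1_card.
rewrite (partition_big (fun q : vec * {set T} => vsupp q.1 :|: q.2) (mem K)) /=; last first.
  by move=> q /and3P[].
apply: eq_bigr => s sK; rewrite (partition_big snd
  (fun A : {set T} => A \in [set B : {set T} | B \subset s & #|B| == 2])) /=; last first.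
  by move=> [m A] /andP[/and3P[/= _ cA _] /eqP <-]; rewrite inE subsetUr cA.
rewrite -cards_draws -sum_nat_const; apply: eq_bigr => A; rewrite inE => /andP[As cA].
have wE : n.+1 - #|s| + #|s :\: A| = n.-1.
  rewrite cardsD (setIidPr As) (eqP cA).
  have := ps_dim psK sK; have := subset_leq_card As; rewrite (eqP cA).
  by case: n n3 #|s| => [|[|[|N]]] // _ [|[|[|[|?]]]] // _ _; rewrite /= ?subSS ?subn0 ?addn0 ?addn1.
rewrite sum1dep_card -(@card_compositions_shift s (s :\: A)) ?subsetDl ?wE ?leq_pred //.
rewrite -(@card_imset _ _ (fun m => (m, A))); last by move=> m m' [].
apply: eq_card => -[m B]; rewrite !inE /=; apply/idP/imsetP.
  case/andP=> /andP[/and3P[/= /eqP wm cB mB] /eqP sE] /eqP BA; exists m; last by rewrite BA.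
  rewrite BA in sE; rewrite inE -wm /= eqxx andbT -sE subsetUl andbT.
  by rewrite setDUl setDv setU0 subsetDl.
case=> m'; rewrite inE => /and3P[sA ms /eqP wm] [-> ->]; rewrite eqxx andbT /edge_cell /=.
have -> : vsupp m' :|: A = s.
  apply/eqP; rewrite eqEsubset subUset ms As; apply/subsetP=> x xs.
  by rewrite inE orbC; case: (boolP (x \in A)) => //= xA; apply: (subsetP sA); rewrite inE xA.
by rewrite eqxx cA sK !andbT wm prednK.
Qed.

Lemma card_grid_face : 2 < n ->
  #|{: grid_face}| = \sum_(s in K) (#|s| == 3) *
    (#|compositions s n.-1| + #|compositions s n.-2|).
Proof.
move=> n3; rewrite card_sig -sum1_card.
rewrite (partition_big (fun q : vec * {set T} * bool => q.1.2) (mem K)) /=; last first.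
  by move=> q /and4P[].
apply: eq_bigr => s sK; rewrite sum1dep_card; case: (boolP (#|s| == 3)) => s3; last first.
  rewrite mul0n; apply/eqP; rewrite cards_eq0; apply/eqP/setP=> -[[m t] b].
  rewrite !inE /=; apply/negbTE/negP=> /andP[/and4P[/= t3 _ _ _] /eqP ts].
  by rewrite -ts t3 in s3.
rewrite mul1n -(cardsID [set q : vec * {set T} * bool | q.2]); congr (_ + _).
  rewrite -(@card_imset _ _ (fun m => (m, s, true))); last by move=> m m' [].
  apply: eq_card => -[[m t] b]; rewrite !inE /=; apply/idP/imsetP.
    case/andP=> /andP[/and4P[/= _ _ mt]] + /eqP ts; case: b => //= /eqP wm _.
    exists m; last by rewrite ts.
    by rewrite inE -ts mt /= -(succnK (wt m)) wm.
  case=> c; rewrite inE => /andP[sc /eqP wc] [-> -> ->].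
  by rewrite /face_cell /= s3 sK sc wc eqxx !andbT prednK ?eqxx.
rewrite -(@card_imset _ _ (fun m => (m, s, false))); last by move=> m m' [].
apply: eq_card => -[[m t] b]; rewrite !inE /=; apply/idP/imsetP.
  case/and3P; case: b => //= _ /and4P[/= _ _ mt /eqP wm] /eqP ts.
  exists m; last by rewrite ts.
  by rewrite inE -ts mt /= -(succnK (wt m)) -(succnK (wt m).+1) wm.
case=> c; rewrite inE => /andP[sc /eqP wc] [-> -> ->].
by rewrite /face_cell /= s3 sK sc wc eqxx !andbT; apply/eqP; lia.
Qed.

(** Invariance of the Euler characteristic under subdivision, arranged to avoid subtraction. An edge
    of [K] contributes [(n - 1) - n]; a triangle contributes a second difference of binomial
    coefficients, which is 1. *)
Lemma grid_euler_char : 2 < n ->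
  #|{: grid_vertex}| + #|{: grid_face}| + faces_of_size 2
  = #|{: grid_edge}| + faces_of_size 1 + faces_of_size 3.
Proof.
move=> n3; rewrite card_grid_vertex // card_grid_edge // card_grid_face //.
pose c k r := if k == 1 then 1 else if k == 2 then r.+1 else 'C(r.+2, 2).
have cE s r : s \in K -> r <= n -> #|compositions s r| = c #|s| r.
  move=> sK rn; have := ps_dim psK sK; have : 0 < #|s|.
    by rewrite card_gt0; apply: contraTneq sK => ->; apply: ps_nonempty.
  case cs: #|s| => [|[|[|[|?]]]] // _ _; rewrite /c /=.
  - exact: card_compositions_cards1.
  - exact: card_compositions_cards2.
  - exact: card_compositions_cards3.
rewrite (eq_bigr (fun s => c #|s| (n - #|s|))) => [|s sK]; last first.
  by rewrite cE // leq_subr.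
rewrite (sum_by_size (fun k => c k (n - k))).
rewrite [in RHS](eq_bigr (fun s => 'C(#|s|, 2) * c #|s| (n.+1 - #|s|))) => [|s sK]; last first.
  have [s1|s1] := leqP #|s| 1; last by rewrite cE // leq_subLR; lia.
  by rewrite bin_small.
rewrite (sum_by_size (fun k => 'C(k, 2) * c k (n.+1 - k))).
rewrite (eq_bigr (fun s => (#|s| == 3) * (c #|s| n.-1 + c #|s| n.-2))) => [|s sK]; last first.
  by rewrite !cE //; lia.
rewrite (sum_by_size (fun k => (k == 3) * (c k n.-1 + c k n.-2))).
have pascal k : 'C(k.+3, 2) = k.+2 + 'C(k.+2, 2) by rewrite binS bin1 addnC.
case: n n3 => [|[|[|N]]] // _; rewrite /c /= !subSS !subn0 !pascal.
have -> : 'C(1, 2) = 0 by [].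
have -> : 'C(2, 2) = 1 by [].
move: (faces_of_size 1) (faces_of_size 2) (faces_of_size 3) 'C(_, _) => f1 f2 f3 X.
clear; lia.
Qed.

End Grid.

(** * Triangulated surfaces *)

Section TriangulatedSurface.
Variables (T : finType) (K : {set {set T}}).
Hypothesis surf : triangulated_surface K.

Let K0 : set0 \notin K. Proof. by case: surf => -[]. Qed.
Let Kface (s t : {set T}) : t \in K -> s \subset t -> s != set0 -> s \in K.
Proof. by case: surf => -[_ h] _ _ _; apply: h. Qed.

Let K1 (s : {set T}) x : s \in K -> x \in s -> [set x] \in K.
Proof. by move=> sK xs; apply: Kface sK _ _; rewrite ?sub1set // -card_gt0 cards1. Qed.

Let Kn0 s : s \in K -> s != set0.
Proof. by apply: contraTneq => ->. Qed.

Let triangles (s : {set T}) := [set t in K | (#|t| == 3) && (s \subset t)].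

Lemma triangulated_surface_dim (s : {set T}) : s \in K -> #|s| <= 3.
Proof.
move=> sK; have /set0Pn[v vs] := Kn0 sK.
have [_ _ _ lk] := surf; have [_ _ dimL _] := lk v (K1 sK vs).
rewrite (cardsD1 v) vs /= add1n ltnS.
have [->|s1] := eqVneq (s :\ v) set0; first by rewrite cards0.
by apply: dimL; rewrite inE s1 !inE eqxx /= setD1K.
Qed.

(** Removing [x] turns the triangles on the edge into the edges of the link of [x] at [y], and the
    link is a cycle. *)
Lemma triangulated_surface_edge (s : {set T}) : s \in K -> #|s| = 2 -> #|triangles s| = 2.
Proof.
move=> sK /eqP/cards2P[x [y [xy sE]]]; rewrite sE in sK *.
have [_ _ _ lk] := surf; have [_ _ _ deg] := lk x (K1 sK (set21 x y)).
rewrite -(deg y); last first.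
  by rewrite inE -card_gt0 cards1 !inE xy.
rewrite -[RHS](@card_in_imset _ _ (fun t => x |: t)); last first.
  move=> t t'; rewrite !inE => /andP[/and3P[_ xt _] _] /andP[/and3P[_ xt' _] _] E.
  by rewrite -(setU1K xt) E setU1K.
apply: eq_card => t; rewrite !inE; apply/and3P/imsetP=> [[tK t3]|[r]].
  rewrite subUset !sub1set => /andP[xt yt]; exists (t :\ x); last by rewrite setD1K.
  have c2 : #|t :\ x| == 2 by rewrite -(eqn_add2l (x \in t)) -cardsD1 (eqP t3) xt.
  by rewrite !inE -card_gt0 (eqP c2) eqxx /= setD1K // tK eq_sym xy yt.
rewrite !inE => /andP[/and3P[_ xr rK] /andP[yr r2]] ->.
by split=> //; [rewrite cardsU1 xr (eqP r2) | rewrite setUS // sub1set].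
Qed.

(** Walking along the connected link of [v] reaches all triangles at [v] through shared edges. A
    walk in the 1-skeleton then changes the vertex, each of its edges lying in some triangle. *)
Lemma triangulated_surface_strong (A : {set {set T}}) (t0 : {set T}) :
  t0 \in K -> #|t0| = 3 -> t0 \in A ->
  (forall s t t' : {set T}, s \in K -> #|s| = 2 -> s \subset t -> s \subset t' ->
     t \in K -> t' \in K -> #|t| = 3 -> #|t'| = 3 -> t \in A -> t' \in A) ->
  forall t : {set T}, t \in K -> #|t| = 3 -> t \in A.
Proof.
move=> t0K t03 t0A closedA.
have around v t1 t2 : t1 \in A -> t1 \in K -> #|t1| = 3 -> v \in t1 ->
    t2 \in K -> #|t2| = 3 -> v \in t2 -> t2 \in A.
  move=> t1A t1K t13 vt1 t2K t23 vt2.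
  have other (t : {set T}) : #|t| = 3 -> v \in t -> exists2 x, x != v & x \in t.
    move=> t3 vt; have /card_gt0P[x] : 0 < #|t :\ v|.
      by rewrite -(ltn_add2l (v \in t)) -cardsD1 t3 vt.
    by rewrite !inE => /andP[xv xt]; exists x.
  have edge x (t : {set T}) : x != v -> x \in t -> v \in t -> t \in K ->
      [set v; x] \in K /\ #|[set v; x]| = 2.
    move=> xv xt vt tK; rewrite cards2 eq_sym xv; split=> //; apply: Kface tK _ _.
      by rewrite subUset !sub1set vt.
    by rewrite -card_gt0 cards2.
  have lkE x (t : {set T}) : x != v -> x \in t -> v \in t -> t \in K -> [set x] \in link K v.
    move=> xv xt vt tK; rewrite inE -card_gt0 cards1 !inE eq_sym xv /=.
    by case: (edge x t).
  have [x1 x1v x1t] := other t1 t13 vt1; have [x2 x2v x2t] := other t2 t23 vt2.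
  have [_ _ _ lk] := surf; have [_ conL _ _] := lk v (K1 t1K vt1).
  have := conL x1 x2 (lkE _ _ x1v x1t vt1 t1K) (lkE _ _ x2v x2t vt2 t2K).
  case/connectP=> p; elim: p x1 x1v t1 t1A t1K t13 vt1 x1t => [|z p IHp] x xv t tA tK t3 vt xt /=.
    move=> _ xE; rewrite xE in x2t; have [sK s2] := edge x t xv xt vt tK.
    by apply: (closedA [set v; x] t t2); rewrite ?subUset ?sub1set ?vt ?vt2 ?xt.
  case/andP=> xzL zp lst.
  (* A path in [connected_complex] may pause, since the pair [[set x; x]] is a vertex. *)
  have [xz|xz] := eqVneq x z; first by apply: (IHp z _ t); rewrite // -xz.
  move: xzL; rewrite !inE => /and3P[_]; rewrite negb_or => /andP[vx vz] tri.
  have c3 : #|v |: [set x; z]| = 3 by rewrite cardsU1 cards2 xz !inE negb_or vx vz.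
  have [sK s2] := edge x t xv xt vt tK.
  apply: (IHp z _ (v |: [set x; z])) => //; rewrite ?setU11 ?inE ?eqxx ?orbT //.
    by rewrite eq_sym.
  apply: (closedA [set v; x] t) => //; first by rewrite subUset !sub1set vt.
  by rewrite subUset !sub1set !inE !eqxx ?orbT.
have [_ _ conn _] := surf.
have [v0 v0t] : exists v, v \in t0 by apply/set0Pn/Kn0.
move=> t tK t3; have [v vt] : exists v, v \in t by apply/set0Pn/Kn0.
have := conn v0 v (K1 t0K v0t) (K1 tK vt).
case/connectP=> p; elim: p v0 t0 t0K t03 t0A v0t => [|z p IHp] x r rK r3 rA xr /=.
  by move=> _ vx; apply: (around x r t) => //; rewrite -vx.
case/andP=> xzK zp lst.
have [xz|xz] := eqVneq x z; first by apply: (IHp z r); rewrite // -xz.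
have s2 : #|[set x; z]| = 2 by rewrite cards2 xz.
have /card_gt0P[w] : 0 < #|triangles [set x; z]| by rewrite triangulated_surface_edge.
rewrite inE subUset !sub1set => /and3P[wK /eqP w3 /andP[xw zw]].
by apply: (IHp z w) => //; apply: (around x r w).
Qed.

Lemma pseudosurface_of_triangulated : pseudosurface K.
Proof.
split.
- exact: K0.
- exact: Kface.
- exact: triangulated_surface_dim.
- exact: triangulated_surface_edge.
- by case: surf.
- exact: triangulated_surface_strong.
Qed.

Lemma euler_char_faces :
  euler_char K = ((faces_of_size K 1)%:Z - (faces_of_size K 2)%:Z + (faces_of_size K 3)%:Z)%R.
Proof.
have E k : (faces_of_size K k)%:Z%R = (\sum_(s in K) (#|s| == k)%:Z)%R.
  by rewrite -(big_morph _ PoszD (erefl _)) /faces_of_size -sum1dep_card big_mkcondr.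
rewrite !E /euler_char -GRing.sumrN -!big_split /=; apply: eq_bigr => s sK.
have := triangulated_surface_dim sK; have := Kn0 sK; rewrite -card_gt0.
by case: #|s| => [|[|[|[|?]]]].
Qed.

End TriangulatedSurface.

Lemma grid_euler_genus (T : finType) (K : {set {set T}}) (n g : nat) :
  triangulated_surface K -> surface_euler_genus K = g%:Z%R -> 2 < n ->
  #|{: grid_edge K n}| + 2 <= #|{: grid_vertex K n}| + #|{: grid_face K n}| + g.
Proof.
move=> surf; rewrite /surface_euler_genus (euler_char_faces surf) => gE n3.
have n0 : 0 < n by apply: leq_ltn_trans n3.
have := grid_euler_char (pseudosurface_of_triangulated surf) n0 n3.
move: gE; move: (faces_of_size K 1) (faces_of_size K 2) (faces_of_size K 3).
move: #|_| #|_| #|_| => a b c f1 f2 f3; clear; lia.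
Qed.

(** * Coloring *)

Lemma card_bigcup_le (I T : finType) (P : pred I) (F : I -> {set T}) k :
  (forall i, P i -> #|F i| <= k) -> #|\bigcup_(i | P i) F i| <= #|[set i | P i]| * k.
Proof.
move=> Fk; rewrite -sum1dep_card big_distrl /=.
elim/big_ind2: _ => [|A a B b Aa Bb|i Pi]; first by rewrite cards0.
  by apply: leq_trans (leq_add Aa Bb); rewrite cardsU leq_subr.
by rewrite mul1n Fk.
Qed.

Lemma card_pairs_degree (V : finType) (e : rel V) (U : {set V}) :
  #|[set q in setX U U | e q.1 q.2]| = \sum_(x in U) #|[set y in U | e x y]|.
Proof.
rewrite -sum1dep_card (eq_bigl (fun q => (q.1 \in U) && ((q.2 \in U) && e q.1 q.2))); last first.
  by move=> [x y]; rewrite !inE andbA.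
rewrite -(pair_big_dep (mem U) (fun x y => (y \in U) && e x y) (fun _ _ => 1)) /=.
by apply: eq_bigr => x _; rewrite sum1dep_card.
Qed.

Lemma degenerate_coloring (V : finType) (e : rel V) k :
  symmetric e -> irreflexive e ->
  (forall U : {set V}, U != set0 -> exists2 v, v \in U & #|[set x in U | e v x]| <= k) ->
  exists c : V -> nat, (forall v, c v <= k) /\ (forall x y, e x y -> c x != c y).
Proof.
move=> sym irr deg.
suff H N : forall U : {set V}, #|U| < N -> exists c : V -> nat,
    (forall v, c v <= k) /\ (forall x y, x \in U -> y \in U -> e x y -> c x != c y).
  have [c [ck cP]] := H _ [set: V] (ltnSn _); exists c; split=> // x y; apply: cP; exact: in_setT.
elim: N => // N IHN U ltU.
have [->|U0] := eqVneq U set0; first by exists (fun=> 0); split=> // x y; rewrite inE.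
have [v vU dv] := deg U U0.
have [|c [ck cP]] := IHN (U :\ v).
  by move: ltU; rewrite (cardsD1 v U) vU.
pose used := [set (inord (c x) : 'I_k.+1) | x in [set x in U | e v x]].
have [i iu] : exists i, i \notin used.
  apply/existsP; rewrite -negb_forall; apply/negP=> /forallP all_used.
  have : #|[set: 'I_k.+1]| <= #|used| by apply/subset_leq_card/subsetP=> i _.
  rewrite cardsT card_ord; apply/negP; rewrite -leqNgt.
  exact: leq_trans (leq_imset_card _ _) _.
exists (fun x => if x == v then i : nat else c x); split.
  by move=> x; case: eqP => // _; rewrite -ltnS.
have new y : y \in U -> e v y -> (i : nat) != c y.
  move=> yU vy; apply: contraNneq iu => ic; apply/imsetP; exists y; first by rewrite inE yU.
  by apply: val_inj; rewrite /= inordK // ltnS.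
move=> x y xU yU xy; case: (eqVneq x v) => [xv|xv]; case: (eqVneq y v) => [yv|yv].
- by rewrite xv yv irr in xy.
- by apply: new; rewrite // -xv.
- by rewrite eq_sym; apply: new; rewrite // -yv sym.
- by apply: cP; rewrite // !inE ?xv ?yv.
Qed.

(** * The core, the orientation and the two vertex colorings *)

Section SparseGraph.
Variables (V : finType) (e : rel V) (g : nat).
Hypotheses (sym : symmetric e) (irr : irreflexive e) (sparse : minor_sparse e g).

(** The fibers of [h] over [U] are stars around their values, hence connected, so the counted pairs
    are edges of a minor. *)
Lemma sparse_star_contraction (U : {set V}) (h : V -> option V) :
  (forall u, u \in U -> h u = Some u) ->
  (forall v u, h v = Some u -> v != u -> e v u) ->
  #|[set q in setX U U | (q.1 != q.2) && [exists v, (h v == Some q.1) && e v q.2]]|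
    <= 6 * (#|U| + g).
Proof.
move=> hU hstar.
pose eB : rel V := fun x y => (x != y) && [exists v, (h v == Some x) && e v y].
have irrB : irreflexive eB by move=> x; rewrite /eB eqxx.
apply: (sparse irrB (p := h)); split=> [u uU | u a b uU ha hb | u v uU vU].
- by exists u; apply: hU.
- have star c : h c = Some u -> connect (fiber_adj e h u) c u.
    move=> hc; have [->|cu] := eqVneq c u; first exact: connect0.
    by apply: connect1; rewrite /fiber_adj /= hstar // hc hU // eqxx.
  apply: connect_trans (star a ha) _; rewrite sym_connect_sym ?star //.
  by move=> x y; rewrite /fiber_adj /= sym [(h x == _) && _]andbC.
- by case/andP=> _ /existsP[w /andP[/eqP hw wv]]; exists w, v; split=> //; apply: hU.
Qed.

Lemma sparse_subgraph (U : {set V}) :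
  #|[set q in setX U U | e q.1 q.2]| <= 6 * (#|U| + g).
Proof.
apply: leq_trans (sparse_star_contraction (U := U)
  (h := fun v => if v \in U then Some v else None) _ _).
- apply/subset_leq_card/subsetP=> -[x y]; rewrite !inE /= => /andP[/andP[xU yU] xy].
  rewrite xU yU /=; apply/andP; split; first by apply: contraTneq xy => ->; rewrite irr.
  by apply/existsP; exists x; rewrite xU eqxx.
- by move=> u ->.
- by move=> v u; case: ifP => // _ [->]; rewrite eqxx.
Qed.

(** Vertices with at most [d] remaining neighbors are peeled off. The one deleted first gets the
    largest rank, so that not exceeding its rank means still being present; the core has rank 0 and
    minimum degree above [d], so sparsity bounds its size. *)
Lemma core_rank d : exists r : V -> nat,
  (forall v, 0 < r v -> #|[set x | e v x && (r x <= r v)]| <= d) /\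
  d.+1 * #|[set x | r x == 0]| <= 6 * (#|[set x | r x == 0]| + g).
Proof.
suff H N : forall U : {set V}, #|U| < N -> exists r : V -> nat,
    (forall v, v \in U -> 0 < r v -> #|[set x in U | e v x && (r x <= r v)]| <= d) /\
    (forall v, v \in U -> r v = 0 -> d < #|[set x in U | e v x && (r x == 0)]|).
  have [r [r1 r2]] := H _ [set: V] (ltnSn _); exists r; split=> [v rv|].
    apply: leq_trans (r1 v (in_setT v) rv); apply/subset_leq_card/subsetP=> x.
    by rewrite !inE.
  apply: leq_trans (sparse_subgraph _); rewrite card_pairs_degree mulnC -sum_nat_const.
  apply: leq_sum => v; rewrite inE => /eqP rv; apply: leq_trans (r2 v (in_setT v) rv) _.
  by apply/subset_leq_card/subsetP=> x; rewrite !inE /= andbC.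
elim: N => // N IHN U ltU.
have [/forall_inP big|] := boolP [forall v in U, d < #|[set x in U | e v x]|].
  exists (fun=> 0); split=> // v vU _; apply: leq_trans (big v vU) _.
  by apply/subset_leq_card/subsetP=> x; rewrite !inE eqxx andbT.
case/forall_inPn=> w wU; rewrite -leqNgt => dw.
have [|r [r1 r2]] := IHN (U :\ w).
  by move: ltU; rewrite (cardsD1 w U) wU.
pose M := (\max_x r x).+1; have rM x : r x < M by rewrite ltnS leq_bigmax.
exists (fun x => if x == w then M else r x); split=> v vU; case: (eqVneq v w) => [->|vw] rv //.
- rewrite ?eqxx; apply: leq_trans dw; apply/subset_leq_card/subsetP=> x.
  by rewrite !inE => /and3P[-> ->].
- apply: leq_trans (r1 v _ rv); last by rewrite !inE vw.
  apply/subset_leq_card/subsetP=> x; rewrite !inE; case: (eqVneq x w) => [->|_] //=.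
  by rewrite leqNgt rM !andbF.
- apply: leq_trans (r2 v _ rv) _; first by rewrite !inE vw.
  by apply/subset_leq_card/subsetP=> x; rewrite !inE; case: (x == w).
Qed.

Section Rank.
Variables (r : V -> nat) (d : nat).
Definition out v := [set x | e v x && (r x <= r v)].
Hypothesis outd : forall v, 0 < r v -> #|out v| <= d.

Definition common_source x y := [exists v, [&& 0 < r v, x \in out v & y \in out v]].
Definition two_step x y := [exists v, [&& 0 < r x, 0 < r v, v \in out x & y \in out v]].
(* Targets [x], [y] of edges [v -> x], [w -> y] that may share a color must
   not be adjacent here. *)
Definition target_adj : rel V :=
  fun x y => (x != y) && [|| e x y, common_source x y, two_step x y | two_step y x].

Lemma target_adj_sym : symmetric target_adj.
Proof.
move=> x y; rewrite /target_adj eq_sym sym [two_step y x || _]orbC; congr (_ && (_ || (_ || _))).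
by apply: eq_existsb => v; rewrite [(x \in _) && _]andbC.
Qed.

(** The summands: 6 for the edges, [d ^ 2 + 6 * d] for common sources, and [d ^ 2] for each
    direction of [two_step]. *)
Definition target_const := 3 * d ^ 2 + 6 * d + 6.

Lemma card_two_step (U : {set V}) :
  #|[set q in setX U U | two_step q.1 q.2]| <= #|U| * d ^ 2.
Proof.
rewrite card_pairs_degree -sum_nat_const; apply: leq_sum => x xU.
have [rx|rx] := posnP (r x).
  rewrite (_ : [set _ in _ | _] = set0) ?cards0 //; apply/setP=> y; rewrite !inE.
  by apply/negbTE/negP=> /andP[_ /existsP[v]]; rewrite rx.
apply: (@leq_trans #|\bigcup_(v | (v \in out x) && (0 < r v)) out v|).
  apply/subset_leq_card/subsetP=> y; rewrite inE => /andP[_ /existsP[v /and4P[_ rv vx yv]]].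
  by apply/bigcupP; exists v; rewrite ?vx.
apply: leq_trans (card_bigcup_le (k := d) _) _; first by move=> v /andP[_ /outd].
rewrite expnS expn1 leq_mul2r; apply/orP; right; apply: leq_trans (outd rx).
by apply/subset_leq_card/subsetP=> v; rewrite inE => /andP[].
Qed.

(** A source in [U] accounts for at most [d ^ 2] pairs. A source outside [U] is contracted onto its
    [i]-th out-neighbor, where it makes that vertex adjacent to all its other targets; [h i] does
    this for all such sources at once, for each [i < d]. *)
Lemma card_common_source (U : {set V}) :
  #|[set q in setX U U | (q.1 != q.2) && common_source q.1 q.2]|
    <= #|U| * d ^ 2 + d * (6 * (#|U| + g)).
Proof.
pose A := \bigcup_(v | (v \in U) && (0 < r v)) setX (out v) (out v).
pose h (i : 'I_d) v := if v \in U then Some v else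
  if i < size (enum (out v)) then Some (nth v (enum (out v)) i) else None.
pose Bi i := [set q in setX U U | (q.1 != q.2) && [exists v, (h i v == Some q.1) && e v q.2]].
pose B := \bigcup_i Bi i.
have cA : #|A| <= #|U| * d ^ 2.
  apply: leq_trans (card_bigcup_le (k := d ^ 2) _) _.
    move=> v /andP[_ rv]; rewrite cardsX expnS expn1.
    by apply: leq_mul; apply: outd.
  by rewrite leq_mul2r; apply/orP; right; apply/subset_leq_card/subsetP=> v; rewrite inE => /andP[].
have cB : #|B| <= d * (6 * (#|U| + g)).
  apply: leq_trans (card_bigcup_le (k := 6 * (#|U| + g)) _) _; last first.
    by rewrite leq_mul2r; apply/orP; right; rewrite (leq_trans (max_card _)) ?card_ord.
  move=> i _; apply: sparse_star_contraction => [u uU|v u]; first by rewrite /h uU.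
  rewrite /h; case: ifP => [_ [->]|_]; first by rewrite eqxx.
  case: ifP => // lti [<-] _.
  have : nth v (enum (out v)) i \in out v by rewrite -mem_enum mem_nth.
  by rewrite inE => /andP[].
apply: leq_trans (leq_add cA cB).
apply: (@leq_trans #|A :|: B|); last by rewrite cardsU leq_subr.
apply/subset_leq_card/subsetP=> -[x y]; rewrite !inE /=.
case/andP=> /andP[xU yU] /andP[xy /existsP[v /and3P[rv xv yv]]].
have [vU|vU] := boolP (v \in U).
  apply/orP; left; apply/bigcupP; exists v; first by rewrite vU.
  by rewrite inE /= xv.
apply/orP; right; have xe : x \in enum (out v) by rewrite mem_enum.
have lti : index x (enum (out v)) < d.
  by apply: leq_trans (outd rv); rewrite cardE index_mem.
apply/bigcupP; exists (Ordinal lti) => //; rewrite !inE /= xU yU xy /=.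
apply/existsP; exists v; rewrite /h (negbTE vU) /= index_mem xe nth_index // eqxx /=.
by move: yv; rewrite inE => /andP[].
Qed.

Lemma card_target_adj (U : {set V}) :
  #|[set q in setX U U | target_adj q.1 q.2]| <= target_const * (#|U| + g).
Proof.
have c1 := sparse_subgraph U; have c2 := card_common_source U.
have c3 := card_two_step U.
have c4 : #|[set q in setX U U | two_step q.2 q.1]| <= #|U| * d ^ 2.
  apply: leq_trans c3; rewrite -(card_imset _ (f := fun q : V * V => (q.2, q.1))).
    apply/subset_leq_card/subsetP=> _ /imsetP[[x y] + ->]; rewrite !inE /=.
    by rewrite [(y \in U) && _]andbC.
  by move=> [x y] [x' y'] /= [-> ->].
set S1 := [set _ in _ | _] in c1; set S2 := [set _ in _ | _] in c2.
set S3 := [set _ in _ | _] in c3; set S4 := [set _ in _ | _] in c4.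
apply: (@leq_trans #|S1 :|: S2 :|: S3 :|: S4|).
  apply/subset_leq_card/subsetP=> -[x y]; rewrite !inE /=.
  by case/andP=> -> /andP[->] /=; rewrite !orbA.
have := cardsU (S1 :|: S2 :|: S3) S4; have := cardsU (S1 :|: S2) S3; have := cardsU S1 S2.
rewrite /target_const; move: c1 c2 c3 c4; rewrite !expnS expn0 muln1.
move: #|S1| #|S2| #|S3| #|S4| #|S1 :|: S2| #|S1 :|: S2 :|: S3| #|S1 :|: S2 :|: S3 :|: S4| #|U|.
move: #|_| #|_| #|_| => a1 a2 a3 s1 s2 s3 s4 t1 t2 t3 u.
clear; nia.
Qed.

(** A set [U] with all degrees above [D] has more than [D] elements, hence [g <= L.+1 * #|U|]. The
    genus term of the density bound is then absorbed by [#|U|], and the average degree is at most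
    [target_const * L.+2], a contradiction. *)
Lemma target_coloring L : exists c : V -> nat,
  (forall v, c v <= maxn (g %/ L.+1) (target_const * L.+2)) /\
  (forall x y, target_adj x y -> c x != c y).
Proof.
set D := maxn _ _; apply: degenerate_coloring; first exact: target_adj_sym.
  by move=> x; rewrite /target_adj eqxx.
move=> U U0; apply/exists_inP; rewrite -[[exists _ in _, _]]negbK negb_exists_in.
apply/negP=> /forall_inP big.
have low : #|U| * D.+1 <= target_const * (#|U| + g).
  apply: leq_trans (card_target_adj U); rewrite card_pairs_degree -sum_nat_const.
  by apply: leq_sum => v /big; rewrite -ltnNge.
have DU : D < #|U|.
  have /set0Pn[v vU] := U0; have := big v vU; rewrite -ltnNge => /leq_trans; apply.
  by apply/subset_leq_card/subsetP=> x; rewrite inE => /andP[].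
have gU : g <= L.+1 * #|U|.
  have : g %/ L.+1 < #|U| by apply: leq_ltn_trans DU; apply: leq_maxl.
  by rewrite ltn_divLR // mulnC => /ltnW.
have : #|U| * D.+1 <= #|U| * (target_const * L.+2).
  apply: leq_trans low _; rewrite mulnCA leq_mul2l; apply/orP; right.
  by rewrite (mulnC #|U|) mulSn leq_add2l.
rewrite leq_pmul2l; last by apply: leq_ltn_trans DU.
by rewrite leqNgt ltnS leq_maxr.
Qed.

(** In any set, all neighbors of a deleted vertex of largest rank are among its out-neighbors. *)
Lemma source_coloring : exists c : V -> nat, (forall v, c v <= d) /\
  (forall x y, 0 < r x -> 0 < r y -> e x y -> c x != c y).
Proof.
pose e' : rel V := fun x y => [&& 0 < r x, 0 < r y & e x y].
have [||U|c [cd cP]] := @degenerate_coloring V e' d.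
- by move=> x y; rewrite /e' sym andbCA.
- by move=> x; rewrite /e' irr !andbF.
- case/set0Pn=> v0 v0U; case: (arg_maxnP r v0U) => v vU vmax; exists v => //.
  have [rv|rv] := posnP (r v).
    by rewrite (_ : [set _ in _ | _] = set0) ?cards0 //; apply/setP=> x; rewrite !inE /e' rv andbF.
  apply: leq_trans (outd rv); apply/subset_leq_card/subsetP=> x; rewrite !inE /e'.
  by case/and4P=> xU _ _ -> /=; apply: vmax.
by exists c; split=> // x y rx ry xy; apply: cP; rewrite /e' rx ry.
Qed.

End Rank.
End SparseGraph.

(** * The injective edge coloring *)

Section Coloring.
Variable G : sgraph.

Lemma edgesP (f : {set G}) : reflect (exists x y, adj x y /\ f = [set x; y]) (f \in edges G).
Proof.
rewrite inE; apply: (iffP existsP) => [[x /existsP[y /andP[xy /eqP ->]]]|[x [y [xy ->]]]].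
  by exists x, y.
by exists x; apply/existsP; exists y; rewrite xy eqxx.
Qed.

Lemma adj_edge (x y : G) : [set x; y] \in edges G -> adj x y.
Proof.
case/edgesP=> a [b [ab /setP E]]; have aNb : a != b.
  by apply: contraTneq ab => ->; rewrite adj_irr.
have := E a; have := E b; have := E x; have := E y; rewrite !inE !eqxx ?orbT /=.
move=> /esym /orP[] /eqP-> /esym /orP[] /eqP-> //; rewrite ?orbb.
- by rewrite eq_sym (negbTE aNb).
- by rewrite adj_sym.
- by move=> _; rewrite (negbTE aNb).
Qed.

Lemma card_edges_within (W : {set G}) :
  2 * #|[set f in edges G | f \subset W]| <= #|[set q in setX W W | adj q.1 q.2]|.
Proof.
set EW := [set f in _ | _]; set P := [set q in _ | _].
rewrite -[#|P|]sum1_card (partition_big (fun q : G * G => [set q.1; q.2]) (mem EW)) /=; last first.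
  move=> [x y] /setIdP[/setXP[/= xW yW] xy]; apply/setIdP; split.
    by apply/edgesP; exists x, y.
  by rewrite subUset !sub1set xW.
rewrite mulnC -sum_nat_const; apply: leq_sum => f /setIdP[/edgesP[x [y [xy ->]]]].
rewrite subUset !sub1set => /andP[xW yW]; rewrite sum1dep_card.
have xNy : x != y by apply: contraTneq xy => ->; rewrite adj_irr.
rewrite (_ : 2 = #|[set (x, y); (y, x)]|); last by rewrite cards2 xpair_eqE negb_and xNy.
have inP a b : a \in W -> b \in W -> adj a b -> (a, b) \in P.
  by move=> aW bW ab; apply/setIdP; split=> //; apply/setXP.
apply/subset_leq_card/subsetP=> q /set2P[]->; rewrite in_set inP ?eqxx //=.
  by rewrite finset.setUC.
by rewrite adj_sym.
Qed.

Variables (r c c' : G -> nat) (p q : nat).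
Hypothesis c_lt : forall v, c v < q.
Hypothesis c'_lt : forall v, c' v < p.
Hypothesis c_proper : forall x y, target_adj (@adj G) r x y -> c x != c y.
Hypothesis c'_proper : forall v w, 0 < r v -> 0 < r w -> adj v w -> c' v != c' w.

Let W := [set v | r v == 0].
Let EW := [set f in edges G | f \subset W].
Let arrow (a : G * G) := (0 < r a.1) && (a.2 \in out (@adj G) r a.1).

(* [c' v * q + c x] encodes the pair [(c' v, c x)]; the value 0 never occurs on an edge. *)
Definition core_coloring (f : {set G}) : nat :=
  if f \subset W then (index f (enum EW)).+1
  else if [pick a : G * G | arrow a && (f == [set a.1; a.2])] is Some a
       then #|EW| + (c' a.1 * q + c a.2).+1 else 0.

Lemma core_coloring_out (f : {set G}) : f \in edges G -> ~~ (f \subset W) ->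
  exists v x, [/\ 0 < r v, adj v x, r x <= r v, f = [set v; x]
    & core_coloring f = #|EW| + (c' v * q + c x).+1].
Proof.
move=> fE fW; rewrite /core_coloring (negbTE fW).
case: pickP => [[v x] /= /andP[/andP[/= rv]]|].
  by rewrite inE => /andP[vx xv] /eqP ->; exists v, x.
case/edgesP: fE fW => x [y [xy ->]]; rewrite subUset !sub1set !inE negb_and -!lt0n => rxy no.
case: (leqP (r y) (r x)) => ryx.
  have := no (x, y); rewrite /arrow inE /= xy ryx eqxx !andbT => rx0.
  by case/orP: rxy => rr; [rewrite rr in rx0 | rewrite (leq_trans rr ryx) in rx0].
have := no (y, x); rewrite /arrow inE /= adj_sym xy (ltnW ryx) finset.setUC eqxx !andbT.
by rewrite (leq_ltn_trans _ ryx).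
Qed.

Lemma core_coloring_in (f : {set G}) : f \in edges G -> f \subset W ->
  core_coloring f = (index f (enum EW)).+1 /\ index f (enum EW) < #|EW|.
Proof.
move=> fE fW; rewrite /core_coloring fW; split=> //.
by rewrite cardE index_mem mem_enum inE fE.
Qed.

(** For two equally colored edges [v -> x] and [v' -> x'], a third edge joining [v] to [v']
    contradicts [c'_proper], and one joining [x] to [x'] contradicts [c_proper]. In the mixed cases
    [outP] applies, where equality of the targets would make the third edge one of the two given
    ones. *)
Lemma core_coloring_injective : injective_edge_coloring core_coloring.
Proof.
move=> f f' fE f'E ne same [h [hE hf hf' [y [z [yf zf' hyz]]]]].
have [fW|fW] := boolP (f \subset W); have [f'W|f'W] := boolP (f' \subset W).
- have [E lt] := core_coloring_in fE fW; have [E' lt'] := core_coloring_in f'E f'W.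
  rewrite E E' in same; case: same => same; case/negP: ne; apply/eqP.
  have fEW : f \in enum EW by rewrite mem_enum inE fE.
  have f'EW : f' \in enum EW by rewrite mem_enum inE f'E.
  by rewrite -(nth_index set0 fEW) same nth_index.
- have [E lt] := core_coloring_in fE fW; have [v [x [_ _ _ _ E']]] := core_coloring_out f'E f'W.
  by move: lt; rewrite ltnNge; case/negP; rewrite -ltnS -E same E' addnS ltnS leq_addr.
- have [E lt] := core_coloring_in f'E f'W; have [v [x [_ _ _ _ E']]] := core_coloring_out fE fW.
  by move: lt; rewrite ltnNge; case/negP; rewrite -ltnS -E -same E' addnS ltnS leq_addr.
have [v [x [rv vx xv fvx cE]]] := core_coloring_out fE fW.
have [v' [x' [rv' vx' xv' fvx' cE']]] := core_coloring_out f'E f'W.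
have [cs cx] : c' v = c' v' /\ c x = c x'.
  move: same; rewrite cE cE' => /addnI [E].
  have q0 : 0 < q by apply: leq_ltn_trans (c_lt x).
  split.
    by have := congr1 (divn^~ q) E; rewrite !divnMDl // !divn_small // !addn0.
  by have := congr1 (modn^~ q) E; rewrite !modnMDl !modn_small.
have yz : adj y z by apply: adj_edge; rewrite -hyz.
(* An edge from [u] to [t] points one way or the other: either [u] is a common source of [u'] and
   [t], or [t -> u -> u'] is a two-step path. *)
have outP u u' t : 0 < r u -> adj u u' -> r u' <= r u -> adj u t -> u' = t \/ c u' <> c t.
  move=> ru uu' u'u ut; have [->|u't] := eqVneq u' t; [by left|right].
  have u'o : u' \in out (@adj G) r u by rewrite inE uu'.
  apply/eqP/c_proper; rewrite /target_adj u't /=.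
  have [tu|ut'] := leqP (r t) (r u).
    apply/orP; right; apply/orP; left; apply/existsP; exists u.
    by rewrite ru u'o inE ut tu.
  apply/orP; right; apply/orP; right; apply/orP; right; apply/existsP; exists u.
  by rewrite (leq_ltn_trans _ ut') // ru u'o inE adj_sym ut ltnW.
move: yf zf'; rewrite fvx fvx' => /set2P[] yE /set2P[] zE; rewrite yE zE in yz hyz.
- by have := c'_proper rv rv' yz; rewrite cs eqxx.
- by case: (outP v x x' rv vx xv yz) => // xx'; rewrite hyz -xx' -fvx eqxx in hf.
- rewrite adj_sym in yz; case: (outP v' x' x rv' vx' xv' yz) => [xx'|]; last by rewrite cx.
  by rewrite hyz -xx' finset.setUC -fvx' eqxx in hf'.
- have xx' : x != x' by apply: contraTneq yz => ->; rewrite adj_irr.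
  have := c_proper (x := x) (y := x'); rewrite /target_adj xx' yz cx eqxx.
  by move=> /(_ isT).
Qed.

Lemma inj_chromatic_index_core : inj_chromatic_index G <= #|EW| + p * q.
Proof.
rewrite /inj_chromatic_index; case: ex_minnP => k _; apply; apply/boolp.asboolP.
exists core_coloring; split; first exact: core_coloring_injective.
move=> f fE; have [fW|fW] := boolP (f \subset W).
  have [-> lt] := core_coloring_in fE fW; rewrite /=.
  by apply: leq_trans lt _; rewrite leq_addr.
have [v [x [_ _ _ _ ->]]] := core_coloring_out fE fW.
rewrite addnS ltnS leq0n /= -addnS leq_add2l.
have := c_lt x; have := c'_lt v => cv cx.
apply: (@leq_trans ((c' v).+1 * q)); last by rewrite leq_mul2r cv orbT.
by rewrite mulSn addnC ltn_add2r.
Qed.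

End Coloring.

Lemma inj_chromatic_index_sparse m : 0 < m -> exists g0, forall (G : sgraph) g,
  minor_sparse (@adj G) g -> g0 <= g -> m * inj_chromatic_index G <= (3 * m + 1) * g.
Proof.
(* With [d.+1 = 36 * m + 6] the core bound gives [6 * m * #|W| <= g], so core edges cost, after
   multiplication by [m], at most [3 * m * g + g / 2]. With [L.+1 = 4 * m * d.+1] the
   [d.+1 * (g %/ L.+1 + 1)] other colors cost at most [g / 4 + g / 4]. *)
move=> m0; pose d := 36 * m + 5; pose L := (4 * m * d.+1).-1.
have LE : L.+1 = 4 * m * d.+1 by rewrite prednK // !muln_gt0 m0.
(* The first summand makes [g %/ L.+1] the larger term of the maximum, the second ensures
   [L.+1 <= g]. *)
exists (L.+1 * (target_const d * L.+2) + L.+1) => G g sparse g_large.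
have [r [outd coreW]] := core_rank (@adj_sym G) (@adj_irr G) sparse d.
have [c [cD c_proper]] := target_coloring (@adj_sym G) (@adj_irr G) sparse outd L.
have [c' [c'd c'_proper]] := source_coloring (@adj_sym G) (@adj_irr G) outd.
have := @inj_chromatic_index_core G r c c' d.+1
  (maxn (g %/ L.+1) (target_const d * L.+2)).+1 cD c'd c_proper c'_proper.
set W := [set v | r v == 0] in coreW *; set EW := [set f in _ | _].
have EW3 : 2 * #|EW| <= 6 * (#|W| + g).
  by apply: leq_trans (card_edges_within W) (sparse_subgraph (@adj_sym G) (@adj_irr G) sparse W).
have -> : maxn (g %/ L.+1) (target_const d * L.+2) = g %/ L.+1.
  by apply/maxn_idPl; rewrite leq_divRL // mulnC (leq_trans (leq_addr _ _) g_large).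
have gL : g %/ L.+1 * L.+1 <= g := leq_divM _ _.
have Lg : L.+1 <= g by apply: leq_trans (leq_addl _ _) g_large.
move: coreW EW3 gL Lg; rewrite LE; move: #|EW| #|W| (g %/ _) (inj_chromatic_index G) => EWn w D X.
rewrite /d; clear; nia.
Qed.

(** * Embeddings *)

From mathcomp Require Import all_classical all_reals topology.
From mathcomp Require Import normedtype derive ring lra.

Import Order.TTheory GRing.Theory Num.Theory.
Import numFieldNormedType.Exports.
Local Open Scope ring_scope.

(** * Stars of grid points along a path *)

Section Stars.
Variables (R : realType) (T : finType) (K : {set {set T}}).
Hypothesis surf : triangulated_surface K.

(** All coordinates are rounded down, then as many non-integral ones as needed are rounded up. There
    are enough of these because the missing amount is the sum of the fractional parts, each below
    1. *)
Lemma finite_rounding (y : T -> R) (n : nat) :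
  (forall x, 0 <= y x) -> \sum_x y x = n%:R ->
  exists a : T -> nat, [/\ (\sum_x a x)%N = n, forall x, `|y x - (a x)%:R| < 1
    & forall x, (0 < a x)%N -> 0 < y x].
Proof.
move=> y0 ysum; pose m x := Num.truncn (y x).
have mP x : (m x)%:R <= y x < (m x).+1%:R by apply: Num.Theory.truncn_itv.
pose F := [set x | (m x)%:R != y x]%SET.
have sumF : (\sum_x m x)%:R + \sum_(x in F) (y x - (m x)%:R) = n%:R.
  rewrite -ysum natr_sum [X in _ + X = _]big_mkcond /= -big_split /=; apply: eq_bigr => x _.
  by rewrite inE; case: eqP => [->|_] /=; rewrite ?addr0 // addrC subrK.
have mn : (\sum_x m x <= n)%N.
  rewrite -(ler_nat R) -sumF lerDl; apply: sumr_ge0 => x _.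
  by rewrite subr_ge0; case/andP: (mP x).
have rF : (n - \sum_x m x <= #|F|)%N.
  rewrite -(ler_nat R) natrB // -sumF addrAC subrr add0r -sum1_card natr_sum.
  by apply: ler_sum => x _; have := mP x; rewrite -natr1; lra.
pose B := [set x in take (n - \sum_x m x) (enum F)]%SET.
have BF x : x \in B -> x \in F by rewrite inE => /mem_take; rewrite mem_enum.
have cB : #|B| = (n - \sum_x m x)%N.
  rewrite cardsE (card_uniqP _) ?take_uniq ?enum_uniq // size_takel //.
  by rewrite -cardE.
exists (fun x => m x + (x \in B))%N; split.
- rewrite big_split /= -[RHS](subnKC mn); congr (_ + _)%N.
  by rewrite -cB -sum1_card [RHS]big_mkcond; apply: eq_bigr => x _; case: (x \in B).
- move=> x; have := mP x; rewrite -natr1 natrD ltr_norml.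
  case: (boolP (x \in B)) => [/BF|_]; rewrite ?inE /=; last by lra.
  move=> ne /andP[le lt]; have lt' : (m x)%:R < y x by rewrite lt_neqAle ne.
  by lra.
- move=> x; have := mP x; case: (boolP (x \in B)) => [/BF|_].
    rewrite inE => ne /andP[le lt] _; apply: le_lt_trans (_ : (m x)%:R < _).
      by rewrite ler0n.
    by rewrite lt_neqAle ne le.
  by rewrite addn0 => /andP[le _] m0; apply: lt_le_trans le; rewrite ltr0n.
Qed.

(** For a grid vertex [a] and a point [p] of the realization this is the open star of [a]; the
    coordinate form avoids locating [p] in a cell. *)
Definition in_star n (a : vec T n) (p : T -> R) : bool :=
  [forall x, `|n%:R * p x - (a x)%:R| < 1].

Lemma in_starP n (a : vec T n) p :
  reflect (forall x, `|n%:R * p x - (a x)%:R| < 1) (in_star a p).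
Proof. exact: forallP. Qed.

Lemma in_star_cover n p : (0 < n)%N -> realization R K p ->
  exists a : grid_vertex K n, in_star (val a) p.
Proof.
move=> n0 [p0 psum pK].
have [x||a [suma acl apos]] := @finite_rounding (fun x => n%:R * p x) n.
- by rewrite mulr_ge0 // ler0n.
- by rewrite -mulr_sumr psum mulr1.
pose v : vec T n := [ffun x => inord (a x)].
have vE x : v x = a x :> nat.
  by rewrite ffunE inordK // ltnS -suma (bigD1 x) //= leq_addr.
have wv : wt v = n by rewrite /wt -[RHS]suma; apply: eq_bigr => x _; rewrite vE.
have vP : vertex_cell K v.
  rewrite /vertex_cell /= wv eqxx; case: surf => -[_ face] _ _ _; apply: face pK _ _.
    apply/fintype.subsetP=> x; rewrite !inE vE => /apos; rewrite pmulr_rgt0 ?ltr0n //.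
    by move/lt0r_neq0.
  apply/set0Pn; apply/existsP; rewrite -[[exists _, _]]negbK negb_exists.
  apply/negP=> /forallP z; have : wt v = 0%N.
    by apply: big1 => x _; have := z x; rewrite inE lt0n negbK => /eqP.
  by rewrite wv => n0'; rewrite n0' in n0.
exists (Sub v vP); rewrite SubK; apply/in_starP => x; rewrite vE; exact: acl.
Qed.

Lemma in_star_close n (a b : vec T n) p x :
  in_star a p -> in_star b p -> (a x <= (b x).+1)%N.
Proof.
move=> /in_starP/(_ x) + /in_starP/(_ x); rewrite !ltr_norml -ltnS -(ltr_nat R).
by rewrite -[(b x).+2%:R]natr1 -[(b x).+1%:R]natr1; lra.
Qed.

Lemma in_star_adj n (a b : grid_vertex K n) p : (0 < n)%N -> realization R K p ->
  in_star (val a) p -> in_star (val b) p ->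
  a = b \/ cell_adj (@grid_end T K n) a b.
Proof.
move=> n0 [p0 psum pK] ap bp; have psK := pseudosurface_of_triangulated surf.
have sub (c : grid_vertex K n) : in_star (val c) p ->
    vsupp (val c) \subset [set x | p x != 0]%SET.
  move=> /in_starP cp; apply/fintype.subsetP=> x; rewrite !inE => cx.
  apply: contraTneq (cp x) => ->; rewrite mulr0 sub0r normrN ger0_norm ?ler0n // -leNgt.
  by rewrite ler1n.
apply: (grid_close_adj psK n0 (ps_dim psK pK)) => //; try exact: sub.
- by move=> i; apply: in_star_close ap bp.
- by move=> i; apply: in_star_close bp ap.
Qed.

Definition cpath (c : R -> T -> R) := forall x, continuous (fun t => c t x).

Definition stars n (c : R -> T -> R) (a b : R) : {set grid_vertex K n} :=
  [set v | `[< exists2 t, a <= t <= b & in_star (val v) (c t) >]]%SET.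

Lemma open_stars n (c : R -> T -> R) (D : {set grid_vertex K n}) : cpath c ->
  open [set t | exists2 v, v \in D & in_star (val v) (c t)]%classic.
Proof.
move=> cc; rewrite openE => t [v vD /in_starP vt].
have : \forall s \near t, forall x, `|n%:R * c s x - (val v x)%:R| < 1.
  apply: (@filter_forall _ _ (fun x s => is_true (`|n%:R * c s x - (val v x)%:R| < 1))
    (nbhs t) (nbhs_filter t)) => x.
  have cv : ((n%:R * c s x - (val v x)%:R) @[s --> t] --> n%:R * c t x - (val v x)%:R)%classic.
    by apply: cvgB; [apply: cvgMl_tmp; apply: cc | exact: cvg_cst].
  exact: (cvgr_norm_lt _ cv _ (vt x)).
by apply: filterS => s h; exists v => //; apply/in_starP.
Qed.

(** Stars covering the same point are equal or adjacent. Hence the parameters covered by stars of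
    one component and those covered by the other stars form disjoint open sets that cover the
    interval, which is connected. *)
Lemma stars_connected n c a b : (0 < n)%N -> cpath c ->
  (forall t, realization R K (c t)) ->
  set_connected (cell_adj (@grid_end T K n)) (stars n c a b).
Proof.
move=> n0 cc cK v w vX wX; set X := stars n c a b in vX wX *; set r := [rel x y | _].
pose S := [set u in X | connect r v u]%SET.
have vS : v \in S by apply/finset.setIdP; rewrite connect0.
suff : w \in S by case/finset.setIdP.
have key u u' t : u \in S -> a <= t <= b -> in_star (val u) (c t) ->
    in_star (val u') (c t) -> u' \in S.
  move=> uS tab ut u't; have [<-//|uu'] := in_star_adj n0 (cK t) ut u't.
  have u'X : u' \in X by rewrite inE; apply/asboolP; exists t.
  case/finset.setIdP: uS => uX vu; apply/finset.setIdP; split=> //.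
  by apply: connect_trans vu (connect1 _); rewrite /r /= uu' u'X uX.
have E : (`[a, b] `&` [set t | exists2 u, u \in S & in_star (val u) (c t)])%classic
    = `[a, b]%classic.
  apply: segment_connected.
  - move: vX; rewrite inE => /asboolP[t tab vt]; exists t; split; first by rewrite /= in_itv.
    by exists v.
  - by exists [set t | exists2 u, u \in S & in_star (val u) (c t)]%classic => //; exact: open_stars.
  - exists (~` [set t | exists2 u, u \in ~: S & in_star (val u) (c t)])%classic.
      by apply: open_closedC; apply: open_stars.
    apply/seteqP; split=> t [] /=; rewrite in_itv /= => tab.
      case=> u uS ut; split=> // -[u' u'S u't].
      by move: u'S; rewrite finset.in_setC (key u u' t).
    move=> no; split=> //; have [u ut] := in_star_cover n0 (cK t).
    by exists u => //; apply: contrapT => uS; apply: no; exists u; rewrite // finset.in_setC; apply/negP.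
move: wX; rewrite inE => /asboolP[t tab wt_].
have : (`[a, b]%classic : set R) t by rewrite /= in_itv.
by rewrite -E => -[_ [u uS ut]]; apply: key ut wt_.
Qed.

(** By compactness the two arcs have positive distance in the sum norm, whereas points in a common
    star differ by less than [2 / n] in each coordinate. *)
Lemma paths_apart (c c' : R -> T -> R) (a b a' b' : R) :
  a <= b -> a' <= b' -> cpath c -> cpath c' ->
  (forall s t, a <= s <= b -> a' <= t <= b' -> c s <> c' t) ->
  exists N, forall n, (N <= n)%N -> [disjoint stars n c a b & stars n c' a' b'].
Proof.
move=> ab ab' cc cc' ne.
pose h (z : R * R) := \sum_x `|c z.1 x - c' z.2 x|.
have hc : continuous h.
  have -> : h = \sum_x (fun z : R * R => `|c z.1 x - c' z.2 x|).
    by apply/funext=> z; rewrite /h fct_sumE.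
  move=> z; apply: (big_ind (fun g : R * R -> R => {for z, continuous g})).
  - exact: cst_continuous.
  - by move=> g g' gc gc'; apply: continuousD.
  move=> x _; apply: (@continuous_comp _ _ _ (fun z => c z.1 x - c' z.2 x) Num.norm).
    apply: (@continuousB _ _ _ (fun z => c z.1 x) (fun z => c' z.2 x)).
      by apply: (@continuous_comp _ _ _ fst (fun t => c t x)); [exact: cvg_fst|exact: cc].
    by apply: (@continuous_comp _ _ _ snd (fun t => c' t x)); [exact: cvg_snd|exact: cc'].
  exact: norm_continuous.
pose A := (`[a, b] `*` `[a', b'])%classic : set (R * R).
have [|||c0 c0A hmin] := @compact_EVT_min _ R h A.
- by exists (a, a'); split; rewrite /= in_itv /= lexx.
- by apply: compact_setX; apply: segment_compact.
- exact: continuous_subspaceT.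
have h0 : 0 < h c0.
  rewrite lt_neqAle sumr_ge0 // andbT eq_sym; apply/eqP=> hz.
  move: c0A; rewrite inE => -[]; rewrite /= !in_itv /= => s1 s2; apply: (ne _ _ s1 s2).
  apply/funext=> x; apply/eqP; rewrite -subr_eq0 -normr_le0.
  by rewrite -hz /h (bigD1 x) //= lerDl sumr_ge0.
pose N := (Num.truncn ((2 * #|T|)%:R / h c0)).+1.
exists N => n nN; rewrite disjoint_subset; apply/fintype.subsetP=> v; rewrite !inE.
move=> -[s sab /in_starP vs]; apply/negP=> /asboolP[t tab /in_starP vt].
have : h c0 <= h (s, t) by apply: hmin; rewrite inE; split; rewrite /= in_itv.
apply/negP; rewrite -ltNge.
have n0 : 0 < n%:R :> R by rewrite ltr0n; apply: leq_trans nN.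
rewrite -(ltr_pM2l n0); apply: (@le_lt_trans _ _ (2 * #|T|)%:R).
  rewrite /h /= mulr_sumr natrM mulrC -sum1_card natr_sum mulr_suml; apply: ler_sum => x _.
  rewrite mul1r -[X in X * _](ger0_norm (ltW n0)) -normrM mulrBr.
  have := vs x; have := vt x; rewrite !ltr_norml => /andP[? ?] /andP[? ?].
  by rewrite ler_norml; lra.
rewrite -ltr_pdivrMr //; apply: lt_le_trans (truncnS_gt _) _.
by rewrite ler_nat.
Qed.

End Stars.

Lemma eventually_forall (I : finType) (P : I -> nat -> Prop) :
  (forall i, exists N, forall n, (N <= n)%N -> P i n) ->
  exists N, forall n, (N <= n)%N -> forall i, P i n.
Proof.
move=> /choice[N NP]; exists (\max_i N i)%N => n nN i; apply: NP.
by apply: leq_trans nN; apply: leq_bigmax.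
Qed.

(** * From an embedding to a minor of the grid *)

Section Drawing.
Variables (R : realType) (G : sgraph).

Definition seg (u v : G) (t : R) : {ptws G -> R} :=
  fun x => (1 - t) * (x == u)%:R + t * (x == v)%:R.

(* The retraction of the line onto [0, 1]. *)
Definition unit_clamp (t : R) : R := (1 + `|t| - `|t - 1|) / 2.

Lemma unit_clamp_id t : 0 <= t <= 1 -> unit_clamp t = t.
Proof.
move=> /andP[t0 t1]; rewrite /unit_clamp (ger0_norm t0) ler0_norm ?subr_le0 //.
by field.
Qed.

Lemma unit_clamp_itv t : 0 <= unit_clamp t <= 1.
Proof.
rewrite /unit_clamp; have := ler_normB t 1; have := ler_normB (t - 1) (- 1).
have := lerB_normD t (-1); rewrite !normrN normr1 opprK subrK.
have := ler_normD (t - 1) 1; have := ler_normD t (- t + 1); rewrite normr1 subrK addNKr.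
by rewrite -(normrN (- t + 1)) opprD opprK normr1 => *; lra.
Qed.

Lemma unit_clamp_continuous : continuous unit_clamp.
Proof.
move=> t; apply: cvgMr_tmp; apply: cvgB; last first.
  by apply: cvg_norm; apply: cvgB; [exact: cvg_id | exact: cvg_cst].
by apply: cvgD; [exact: cvg_cst | apply: cvg_norm; exact: cvg_id].
Qed.

Lemma seg_realization u v t : (u == v) || adj u v -> 0 <= t <= 1 ->
  realization R (graph_complex G) (seg u v t).
Proof.
move=> uv /andP[t0 t1]; split.
- by move=> x; rewrite addr_ge0 // mulr_ge0 ?ler0n ?subr_ge0.
- have delta w : \sum_(x : G) (x == w)%:R = 1 :> R.
    by rewrite (bigD1 w) //= eqxx big1 ?addr0 // => x /negbTE ->.
  by rewrite /seg big_split /= -!mulr_sumr !delta !mulr1 subrK.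
have single w : [set w]%SET \in graph_complex G.
  by rewrite finset.in_setU; apply/orP; right; apply: imset_f.
have [uvE|uNv] := eqVneq u v.
  rewrite (_ : [set _ | _]%SET = [set u]%SET) //; apply/setP=> x.
  rewrite !inE /seg uvE -mulrDl subrK mul1r.
  by case: (x == v); rewrite ?oner_eq0 ?eqxx.
have [->|tn0] := eqVneq t 0.
  rewrite (_ : [set _ | _]%SET = [set u]%SET) //; apply/setP=> x.
  rewrite !inE /seg subr0 mul1r mul0r addr0.
  by case: (x == u); rewrite ?oner_eq0 ?eqxx.
have [->|tn1] := eqVneq t 1.
  rewrite (_ : [set _ | _]%SET = [set v]%SET) //; apply/setP=> x.
  rewrite !inE /seg subrr mul0r add0r mul1r.
  by case: (x == v); rewrite ?oner_eq0 ?eqxx.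
rewrite (_ : [set _ | _]%SET = [set u; v]%SET).
  rewrite finset.in_setU; apply/orP; left; rewrite inE; apply/existsP; exists u.
  by apply/existsP; exists v; rewrite eqxx andbT; move: uv; rewrite (negbTE uNv).
apply/setP=> x; rewrite !inE /seg.
have [->|xu] := eqVneq x u.
  by rewrite (negbTE uNv) mulr1 mulr0 addr0 subr_eq0 eq_sym tn1.
by rewrite mulr0 add0r; case: (x == v); rewrite ?mulr1 ?mulr0 ?tn0 ?eqxx.
Qed.

Lemma seg_continuous u v : continuous (seg u v).
Proof.
move=> t; have FF : Filter (seg u v s @[s --> t])%classic by exact: fmap_filter.
have := iffRL (@pointwise_cvgP (discrete_topology G) R _ (seg u v t) FF).
apply => x.
suff : ((1 - s) * (x == u)%:R + s * (x == v)%:R @[s --> t] -->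
  (1 - t) * (x == u)%:R + t * (x == v)%:R)%classic by [].
by apply: cvgD; apply: cvgMr_tmp; [apply: cvgB; [exact: cvg_cst|exact: cvg_id] | exact: cvg_id].
Qed.

Variables (T : finType) (K : {set {set T}}) (f : {ptws G -> R} -> {ptws T -> R}).
Hypothesis surf : triangulated_surface K.
Hypothesis fcont : {within realization R (graph_complex G), continuous f}%classic.
Hypothesis fK : set_fun (realization R (graph_complex G)) (realization R K) f.
Hypothesis finj : set_inj (realization R (graph_complex G)) f.

Let nbr (u v : G) := (u == v) || adj u v.

(** Clamping keeps the path continuous and inside the realization for every real [t], as
    [stars_connected] requires. *)
Definition edge_path (u v : G) (t : R) : T -> R := f (seg u v (unit_clamp t)).

Let segK u v t : nbr u v -> realization R (graph_complex G) (seg u v (unit_clamp t)).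
Proof. by move=> uv; apply: seg_realization uv (unit_clamp_itv t). Qed.

Lemma edge_path_realization u v t : nbr u v -> realization R K (edge_path u v t).
Proof. by move=> uv; apply: fK; apply: segK. Qed.

Lemma edge_path_continuous u v : nbr u v -> cpath (edge_path u v).
Proof.
move=> uv x t.
have fc := (subspace_continuousP _ _).1 fcont (seg u v (unit_clamp t)) (segK t uv).
have sc : (seg u v (unit_clamp s) @[s --> t] --> seg u v (unit_clamp t))%classic.
  by apply: continuous_comp; [exact: unit_clamp_continuous | exact: seg_continuous].
have gc : (edge_path u v s @[s --> t] --> f (seg u v (unit_clamp t)))%classic.
  move=> B /fc /= fB; apply: (@filterS _ _ (nbhs_filter t) _ _ _ (sc _ fB)) => s /=.
    by apply; apply: segK.
exact: (cvg_comp _ _ gc (@proj_continuous T (fun=> R) x _)).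
Qed.

Lemma edge_path_inj u v u' v' s t : nbr u v -> nbr u' v' -> 0 <= s <= 1 -> 0 <= t <= 1 ->
  edge_path u v s = edge_path u' v' t -> forall x, seg u v s x = seg u' v' t x.
Proof.
move=> uv uv' s01 t01 E x; rewrite -{1}(unit_clamp_id s01) -{1}(unit_clamp_id t01).
by rewrite (finj _ _ E) // inE; apply: segK.
Qed.

Lemma edge_path_rev u v t : 0 <= t <= 1 -> edge_path u v (1 - t) = edge_path v u t.
Proof.
move=> t01; rewrite /edge_path !unit_clamp_id //; last by move/andP: t01 => [*]; lra.
by congr f; apply/funext=> x; rewrite /seg opprB addrC subrKC addrC.
Qed.

Lemma edge_path0 u v : edge_path u v 0 = edge_path u u 0.
Proof.
rewrite /edge_path unit_clamp_id ?lexx ?ler01 //; congr f; apply/funext=> x.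
by rewrite /seg !mul0r.
Qed.

(** Edges are cut into thirds: [X u] collects the stars along the first thirds of all edges at [u],
    which share a star at the image of [u], and [Y u w] those along the middle third. [P] lists the
    required disjointness; finitely many arcs are involved, so one [n] serves all. *)
Lemma minor_map_of_embedding : exists n, (2 < n)%N /\
  exists p : grid_vertex K n -> option G,
    minor_map (cell_adj (@grid_end T K n)) [set: G] (@adj G) p.
Proof.
pose P (q : (G * G) * (G * G)) n := let: ((u, w), (u', w')) := q in
  nbr u w -> nbr u' w' ->
  [/\ u != u' -> [disjoint stars K n (edge_path u w) 0 (1/3) & stars K n (edge_path u' w') 0 (1/3)],
      u' != u -> u' != w ->
      [disjoint stars K n (edge_path u w) (1/3) (2/3) & stars K n (edge_path u' w') 0 (1/3)]
    & [set u; w]%SET != [set u'; w']%SET -> u != w -> u' != w' ->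
      [disjoint stars K n (edge_path u w) (1/3) (2/3) & stars K n (edge_path u' w') (1/3) (2/3)]].
have [N NP] : exists N, forall n, (N <= n)%N -> forall q, P q n.
  apply: eventually_forall => -[[u w] [u' w']].
  case uw: (nbr u w); last by exists 0%N => n _; rewrite /P uw.
  case uw': (nbr u' w'); last by exists 0%N => n _; rewrite /P uw'.
  have ap (C : bool) a b a' b' : 0 <= a -> a <= b -> b <= 1 -> 0 <= a' -> a' <= b' -> b' <= 1 ->
    (C -> forall s t, a <= s <= b -> a' <= t <= b' -> exists x, seg u w s x <> seg u' w' t x) ->
    exists N, forall n, (N <= n)%N -> C ->
      [disjoint stars K n (edge_path u w) a b & stars K n (edge_path u' w') a' b'].
    move=> a0 ab b1 a0' ab' b1'; case: C => // [h|_]; last by exists 0%N.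
    have [|N NP] := paths_apart K ab ab' (edge_path_continuous uw) (edge_path_continuous uw').
      move=> s t sab tab E; have [x] := h isT s t sab tab; apply; apply: edge_path_inj E x => //.
        by case/andP: sab => *; lra.
      by case/andP: tab => *; lra.
    by exists N => n nN _; apply: NP.
  (* Arcs are separated by one barycentric coordinate in [G]. Here [u] has weight at least 2/3
     against at most 1/3; in the next two cases a vertex off the edge [u w] has weight 0 against at
     least 2/3, respectively 1/3. *)
  have [|||||||N1 N1P] := ap (u != u') 0 (1/3) 0 (1/3); try lra.
    move=> uu' s t /andP[? ?] /andP[? ?]; exists u; rewrite /seg eqxx (negbTE uu') mulr0 add0r mulr1.
    by case: (u == w); case: (u == w'); rewrite ?mulr0 ?mulr1; lra.
  have [|||||||N2 N2P] := ap ((u' != u) && (u' != w)) (1/3) (2/3) 0 (1/3); try lra.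
    move=> /andP[/negbTE uu' /negbTE uw_] s t /andP[? ?] /andP[? ?]; exists u'.
    rewrite /seg eqxx uu' uw_ !mulr0 mulr1.
    by case: (u' == w'); rewrite ?mulr0 ?mulr1; lra.
  have [|||||||N3 N3P] := ap ([&& [set u; w]%SET != [set u'; w']%SET, u != w & u' != w'])
    (1/3) (2/3) (1/3) (2/3); try lra.
    case/and3P=> ne uNw uNw' s t /andP[? ?] /andP[? ?].
    have [x xs xn] : exists2 x, x \in [set u'; w']%SET & x \notin [set u; w]%SET.
      apply/exists_inP; rewrite -[[exists _ in _, _]]negbK negb_exists_in.
      apply: contra ne => /forall_inP h; rewrite eq_sym eqEcard !cards2 uNw uNw' andbT.
      by apply/fintype.subsetP=> x /h; rewrite negbK.
    exists x; move: xn; rewrite !inE negb_or /seg => /andP[/negbTE-> /negbTE->].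
    case/set2P: xs => ->; rewrite ?eqxx ?mulr0 ?mulr1.
      by rewrite (negbTE uNw') mulr0; lra.
    by rewrite eq_sym (negbTE uNw') mulr0; lra.
  exists (maxn N1 (maxn N2 N3)) => n; rewrite !geq_max => /and3P[n1 n2 n3] _ _.
  by split=> *; [exact: N1P | apply: N2P => //; apply/andP | apply: N3P => //; apply/and3P].
pose n := maxn N 3; have n3 : (2 < n)%N by rewrite leq_max orbT.
have {NP} apart := NP n (leq_maxl _ _).
have n0 : (0 < n)%N by apply: leq_ltn_trans n3.
exists n; split=> //.
have nbrxx u : nbr u u by rewrite /nbr eqxx.
have adjn u v : adj u v -> nbr u v by rewrite /nbr => ->; rewrite orbT.
pose A u w := stars K n (edge_path u w) 0 (1/3).
pose Y u w := stars K n (edge_path u w) (1/3) (2/3).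
pose X u := (\bigcup_(w | nbr u w) A u w)%SET.
have AX u w : nbr u w -> A u w \subset X u by move=> uw; apply: finset.bigcup_sup.
have inA u w t a : 0 <= t <= 1/3 -> in_star (val a) (edge_path u w t) -> a \in A u w.
  by move=> t01 at_; rewrite inE; apply/asboolP; exists t.
have inY u w t a : 1/3 <= t <= 2/3 -> in_star (val a) (edge_path u w t) -> a \in Y u w.
  by move=> t01 at_; rewrite inE; apply/asboolP; exists t.
have stars_conn u w a b : nbr u w ->
    set_connected (cell_adj (@grid_end T K n)) (stars K n (edge_path u w) a b).
  move=> uw; apply: stars_connected => //; first exact: edge_path_continuous.
  by move=> t; apply: edge_path_realization.
apply: (@minor_map_of_connectors _ _ _ _ X Y).
- by move=> x y; apply: eq_existsb => e; rewrite andbC.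
- exact: adj_sym.
- exact: adj_irr.
- move=> v; have [a av] := in_star_cover surf n0 (edge_path_realization 0 (nbrxx v)).
  apply/set0Pn; exists a; apply: (fintype.subsetP (AX v v (nbrxx v))).
  by apply: inA av; apply/andP; split; lra.
- move=> v; have [a0 a0v] := in_star_cover surf n0 (edge_path_realization 0 (nbrxx v)).
  have a0A w : a0 \in A v w.
    by apply: (inA _ _ 0); [apply/andP; split; lra | rewrite edge_path0].
  have toX w : nbr v w -> subrel
      (connect [rel x y | [&& cell_adj (@grid_end T K n) x y, x \in A v w & y \in A v w]])
      (connect [rel x y | [&& cell_adj (@grid_end T K n) x y, x \in X v & y \in X v]]).
    move=> vw; apply: connect_sub => x y /and3P[xy xA yA]; apply: connect1.
    by rewrite /= xy !(fintype.subsetP (AX v w vw)).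
  move=> a b /finset.bigcupP[w vw aw] /finset.bigcupP[w' vw' bw].
  apply: (@connect_trans _ _ a0).
    exact: (toX w vw _ _ (stars_conn v w 0 (1/3) vw _ _ aw (a0A w))).
  exact: (toX w' vw' _ _ (stars_conn v w' 0 (1/3) vw' _ _ (a0A w') bw)).
- by move=> u v uv; apply: stars_conn; apply: adjn.
- move=> u v uv; have nuv := adjn _ _ uv; have nvu : nbr v u by apply: adjn; rewrite adj_sym.
  split; apply/set0Pn.
    have [a au] := in_star_cover surf n0 (edge_path_realization (1/3) nuv).
    have aY : a \in Y u v by apply: inY au; apply/andP; split; lra.
    exists a; rewrite finset.in_setI aY /=.
    by apply: (fintype.subsetP (AX u v nuv)); apply: inA au; apply/andP; split; lra.
  (* The point at 2/3 on the path from [u] is the point at 1/3 on the reversed path, which belongs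
     to the first third at [v]. *)
  have [a au] := in_star_cover surf n0 (edge_path_realization (1/3) nvu).
  have aY : a \in Y u v.
    apply: (inY _ _ (1 - 1/3)); first by apply/andP; split; lra.
    by rewrite edge_path_rev //; apply/andP; split; lra.
  exists a; rewrite finset.in_setI aY /=.
  by apply: (fintype.subsetP (AX v u nvu)); apply: inA au; apply/andP; split; lra.
- move=> u v uv; apply/pred0P=> a /=; apply/negbTE/negP=> /andP[].
  case/finset.bigcupP=> w uw aw /finset.bigcupP[w' vw' aw'].
  have [/(_ uv) /pred0P/(_ a) + _ _] := apart (u, w, (v, w')) uw vw'.
  by rewrite /= aw aw'.
- move=> u v w uv wu wv; apply/pred0P=> a /=; apply/negbTE/negP=> /andP[aY].
  case/finset.bigcupP=> z wz az.
  have [_ /(_ wu wv) /pred0P/(_ a) + _] := apart (u, v, (w, z)) (adjn _ _ uv) wz.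
  by rewrite /= aY az.
- move=> u v u' v' uv uv' ne; have [_ _] := apart (u, v, (u', v')) (adjn _ _ uv) (adjn _ _ uv').
  apply=> //; first by apply: contraTneq uv => ->; rewrite adj_irr.
  by apply: contraTneq uv' => ->; rewrite adj_irr.
Qed.

End Drawing.

Theorem minor_sparse_euler_genus (R : realType) (G : sgraph) (g : nat) :
  is_euler_genus R G g -> minor_sparse (@adj G) g.
Proof.
case=> -[T [K [surf [f [fcont fK finj]] gK]]] _.
have [n [n3 [p pm]]] := minor_map_of_embedding surf fcont fK finj.
have n0 : (0 < n)%N by apply: leq_ltn_trans n3.
apply: minor_sparse_closed_surface pm; last exact: grid_euler_genus.
by apply: closed_surface_grid => //; apply: pseudosurface_of_triangulated.
Qed.

Theorem theorem1p5 (R : realType) (eps : R) (heps : 0 < eps) :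
  exists g0 : nat, forall (G : sgraph) (g : nat),
    is_euler_genus R G g -> (g0 <= g)%N ->
    (inj_chromatic_index G)%:R <= (3 + eps) * g%:R.
Proof.
(* [m] exceeds the inverse of [eps], so the extra term [g] in the bound for [m] times the index is
   at most [m * eps * g]. *)
pose m := (Num.truncn eps^-1).+1.
have m_eps : 1 <= eps * m%:R.
  by rewrite mulrC -ler_pdivrMr // mul1r ltW // truncnS_gt.
have [g0 g0P] := inj_chromatic_index_sparse (ltn0Sn (Num.truncn eps^-1)).
exists g0 => G g /minor_sparse_euler_genus sparse g0g.
have m0 : 0 < m%:R :> R by rewrite ltr0n.
have := g0P G g sparse g0g; rewrite -/m -(ler_nat R) !natrM natrD natrM => bound.
rewrite -(ler_pM2l m0); apply: le_trans bound _.
rewrite mulrA ler_wpM2r ?ler0n //; rewrite mulrDr [m%:R * 3]mulrC lerD2l.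
by rewrite mulrC.
Qed.
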